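(* The moment vectors $\tilde m_r$ satisfy the following recursive equations: $\tilde m_0=\tilde\pi^T$, $$\tilde m_1=\left[\tilde m_0\left(p(P\Lambda-\Gamma_1P\Lambda M)+M-\Lambda\right)-\tilde k_1\right](\Lambda M)^{-1}(pP-I)^{-1},$$ $$\tilde m_2=2\left[\tilde k_2+\tilde m_1\left(p(P\Lambda-\Gamma_1P\Lambda M)+M-\Lambda\right)-\tilde m_0\left(p\left(\tfrac12\Gamma_2P\Lambda M-\Gamma_1P\Lambda\right)+I\right)\right](\Lambda M)^{-1}(pP-I)^{-1},$$ while for $r\ge3$: $$\frac{(-1)^r}{r!}\tilde m_r(I-pP)\Lambda M=\frac{(-1)^{r-2}}{(r-2)!}\tilde m_{r-2}\left[p\left(\tfrac12\Gamma_2P\Lambda M-\Gamma_1P\Lambda\right)+I\right]+\frac{(-1)^{r-1}}{(r-1)!}\tilde m_{r-1}\left[p(P\Lambda-\Gamma_1P\Lambda M)+M-\Lambda\right]$$ $$\qquad+\,p\sum_{j=0}^{r-3}\frac{(-1)^j}{j!}\tilde m_j\left[\frac{(-1)^{r-j-1}}{(r-j-1)!}\Gamma_{r-j-1}P\Lambda+\frac{(-1)^{r-j}}{(r-j)!}\Gamma_{r-j}P\Lambda M\right].$$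
   Context: Setting (Model II). $\{Z_n\}_{n\ge0}$ is an irreducible discrete-time Markov chain on $\{1,\dots,N\}$ with transition matrix $P=(p_{i,j})$ and stationary distribution $\tilde\pi=(\pi_1,\dots,\pi_N)^T$. $W_n\ge0$ satisfies $W_{n+1}=[V_nW_n+Y_n(V_n)]^+$, $[x]^+=\max\{x,0\}$, where the $V_n$ are i.i.d., $V_n$ is independent of $W_n$, of the background chain and of the variables $S,A,C,D$, $P(V_n=1)=p\in(0,1)$, $P(V_n=-1)=q=1-p$, and $$Y_n(1)=S_n-A_{n+1},\qquad Y_n(-1)=D_{n+1}-C_n.$$ All of $S_n,A_n,C_n,D_n$ are nonnegative. Given $Z_n=i$, the pair $(A_{n+1},S_n)$ together with $Z_{n+1}$ is independent of the past and $P(A_{n+1}\le x,S_n\le y,Z_{n+1}=j\mid Z_n=i)=p_{i,j}B_i(y)(1-e^{-\lambda_jx})$; likewise $P(D_{n+1}\le x,C_n\le y,Z_{n+1}=j\mid Z_n=i)=p_{i,j}C_i(y)(1-e^{-\mu_jx})$, where $\lambda_j,\mu_j>0$ and $B_i(\cdot)$, $C_i(\cdot)$ are arbitrary distribution functions on $[0,\infty)$ with Laplace–Stieltjes transforms $\beta_i^*(s)=\int_0^\infty e^{-st}dB_i(t)$, $c_i^*(s)=\int_0^\infty e^{-st}dC_i(t)$. $\Phi_{W,i}(s)=\lim_{n\to\infty}E(e^{-sW_n}1_{\{Z_n=i\}})$, $\mathrm{Re}(s)\ge0$, where the limits are assumed to exist. $\Lambda=\mathrm{diag}(\lambda_1,\dots,\lambda_N)$,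 $M=\mathrm{diag}(\mu_1,\dots,\mu_N)$. $\tilde k_l=(k_{1,l},\dots,k_{N,l})$, $l=1,2$, where for $j=1,\dots,N$: $k_{j,1}=q\pi_j\mu_j+\mu_jv_j^{(1)}-\lambda_jv_j^{(-1)}$, $k_{j,2}=v_j^{(1)}+v_j^{(-1)}$, $v_j^{(1)}=p\sum_{i=1}^{N}p_{i,j}\beta_i^*(\lambda_j)\Phi_{W,i}(\lambda_j)$, $v_j^{(-1)}=q[\pi_j-\sum_{i=1}^{N}p_{i,j}c_i^*(\mu_j)\Phi_{W,i}(\mu_j)]$. Moments (assumed to exist and be finite): $m_{r,i}=\lim_{n\to\infty}E(W_n^r1_{\{Z_n=i\}})$ is the $r$-th moment of the steady-state distribution on the event that the background state is $i$, $\tilde m_r=(m_{r,1},\dots,m_{r,N})$ (row vector), $\gamma_{r,i}=\int_0^\infty x^r\,dB_i(x)$, $\Gamma_r=\mathrm{diag}(\gamma_{r,1},\dots,\gamma_{r,N})$, $r=0,1,2,\dots$; in particular $\Gamma_0=I$. *)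

(* Defs.v *)
From HB Require Import structures.
From mathcomp Require Import all_boot all_order all_algebra.
From mathcomp Require Import complex.
From mathcomp Require Import all_classical all_reals all_analysis.

Set Implicit Arguments.
Unset Strict Implicit.
Unset Printing Implicit Defensive.

Import Order.TTheory GRing.Theory Num.Theory.
Import numFieldNormedType.Exports.

Local Open Scope classical_set_scope.
Local Open Scope ring_scope.
Local Open Scope complex_scope.

(** Indexing: the state space {1,...,N} is ['I_N].  Vectors of parameters
    indexed by the states are row vectors, except for the stationary
    distribution, which is a column vector. *)

Section Chains.
Context {R : realType} {N : nat}.

Definition stochastic (P : 'M[R]_N) : Prop :=
  (forall i j, 0 <= P i j) /\ (forall i, \sum_j P i j = 1).

Definition irreducible (P : 'M[R]_N) : Prop :=
  forall i j, exists n : nat, 0 < (P ^+ n) i j.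

Definition stationary (P : 'M[R]_N) (pi : 'cV[R]_N) : Prop :=
  [/\ forall i, 0 <= pi i 0, \sum_i pi i 0 = 1 & pi^T *m P = pi^T].

End Chains.

Section Probability.
Context d (T : measurableType d) {R : realType} (Pr : probability T R).

(** [Pr (E | F)]; only meaningful when [Pr F] is nonzero. *)
Definition cprob (E F : set T) : R := fine (Pr (E `&` F)) / fine (Pr F).

(** The sigma-algebra generated by a family of real functions. *)
Definition sigma_gen (F : set (T -> R)) : set (set T) :=
  <<s \bigcup_(X in F) preimage_set_system setT X measurable >>.

Definition indep (G H : set (set T)) : Prop :=
  forall E K, G E -> H K -> Pr (E `&` K) = (Pr E * Pr K)%E.

Definition cond_indep (F : set T) (G H : set (set T)) : Prop :=
  (0 < Pr F)%E -> forall E K, G E -> H K ->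
  cprob (E `&` K) F = cprob E F * cprob K F.

Definition mutually_indep (X : nat -> T -> R) : Prop :=
  forall (J : seq nat) (U : nat -> set R), uniq J ->
  (forall k, measurable (U k)) ->
  Pr (\bigcap_(k in [set` J]) (X k @^-1` U k)) =
  (\prod_(k <- J) Pr (X k @^-1` U k))%E.

Definition cexp (z : R[i]) : R[i] :=
  (expR (complex.Re z) * cos (complex.Im z))
  +i* (expR (complex.Re z) * sin (complex.Im z)).

Definition cexpectation (f : T -> R[i]) : R[i] :=
  (\int[Pr]_w complex.Re (f w)) +i* (\int[Pr]_w complex.Im (f w)).

Definition ccvg (u : nat -> R[i]) (l : R[i]) : Prop :=
  ((fun n => complex.Re (u n)) @ \oo --> complex.Re l) /\
  ((fun n => complex.Im (u n)) @ \oo --> complex.Im l).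

End Probability.

Section Model.
Context {R : realType} {N : nat} d (T : measurableType d)
  (Pr : probability T R).
Variables (P : 'M[R]_N) (p : R) (lam mu : 'rV[R]_N).
(** The distribution functions B_i and C_i are given by the probability
    measures they determine: B_i(y) = B i `]-oo, y].  [C i] is the law with
    distribution function C_i, [Cn n] the random variable C_n. *)
Variables (B C : 'I_N -> probability R R).
Variables (Z : nat -> T -> 'I_N) (V W S A Cn D : nat -> T -> R).

(** [Z n] as a real function; it generates the same sigma-algebra as [Z n]. *)
Definition realZ (n : nat) (w : T) : R := (Z n w : nat)%:R.

(** All the variables known at time n.  The variables A and D with index k+1,
    and S, C and V with index k, govern the step from k to k+1. *)
Definition past (n : nat) : set (set T) :=
  sigma_gen
    ((\bigcup_(k in [set k | (k <= n)%N]) [set W k; realZ k]) `|`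
     (\bigcup_(k in [set k | (k < n)%N])
        [set V k; S k; A k.+1; Cn k; D k.+1])).

Definition environment : set (T -> R) :=
  \bigcup_k [set realZ k; S k; A k.+1; Cn k; D k.+1].

Definition Y (n : nat) (v : R) (w : T) : R :=
  if v == 1 then S n w - A n.+1 w else D n.+1 w - Cn n w.

Record model_II : Prop := ModelII {
  mII_lam : forall j, 0 < lam 0 j;
  mII_mu : forall j, 0 < mu 0 j;
  mII_B : forall i, B i `[0%R, +oo[%classic = 1%E;
  mII_C : forall i, C i `[0%R, +oo[%classic = 1%E;

  mII_Z_meas : forall n i, measurable (Z n @^-1` [set i]);
  mII_Z_markov : forall n (z : nat -> 'I_N) j,
    (0 < Pr (\bigcap_(k in [set k | (k <= n)%N]) (Z k @^-1` [set z k])))%E ->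
    cprob Pr (Z n.+1 @^-1` [set j])
      (\bigcap_(k in [set k | (k <= n)%N]) (Z k @^-1` [set z k])) = P (z n) j;

  mII_W_ge0 : forall n w, 0 <= W n w;
  mII_S_ge0 : forall n w, 0 <= S n w;
  mII_A_ge0 : forall n w, 0 <= A n.+1 w;
  mII_C_ge0 : forall n w, 0 <= Cn n w;
  mII_D_ge0 : forall n w, 0 <= D n.+1 w;
  mII_W_rec : forall n w,
    W n.+1 w = Num.max (V n w * W n w + Y n (V n w) w) 0;

  mII_V_law1 : forall n, Pr (V n @^-1` [set 1]) = p%:E;
  mII_V_lawN1 : forall n, Pr (V n @^-1` [set -1]) = (1 - p)%:E;
  mII_V_iid : mutually_indep Pr V;
  mII_V_indep : forall n,
    indep Pr (sigma_gen [set V n]) (sigma_gen (W n |` environment));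

  mII_AS_past : forall n i, cond_indep Pr (Z n @^-1` [set i])
    (sigma_gen [set A n.+1; S n; realZ n.+1]) (past n);
  mII_AS_law : forall n i j x y, (0 < Pr (Z n @^-1` [set i]))%E ->
    0 <= x -> 0 <= y ->
    cprob Pr [set w | [/\ A n.+1 w <= x, S n w <= y & Z n.+1 w = j]]
      (Z n @^-1` [set i]) =
    P i j * fine (B i `]-oo, y]%classic) * (1 - expR (- lam 0 j * x));

  mII_DC_past : forall n i, cond_indep Pr (Z n @^-1` [set i])
    (sigma_gen [set D n.+1; Cn n; realZ n.+1]) (past n);
  mII_DC_law : forall n i j x y, (0 < Pr (Z n @^-1` [set i]))%E ->
    0 <= x -> 0 <= y ->
    cprob Pr [set w | [/\ D n.+1 w <= x, Cn n w <= y & Z n.+1 w = j]]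
      (Z n @^-1` [set i]) =
    P i j * fine (C i `]-oo, y]%classic) * (1 - expR (- mu 0 j * x))
}.

(** E(e^{-s W_n} 1_{Z_n = i}). *)
Definition transform (n : nat) (i : 'I_N) (s : R[i]) : R[i] :=
  cexpectation Pr (fun w =>
    cexp (- s * (W n w)%:C) * (\1_(Z n @^-1` [set i]) w)%:C).

(** E(W_n^r 1_{Z_n = i}), possibly infinite. *)
Definition moment (n r : nat) (i : 'I_N) : \bar R :=
  'E_Pr[fun w => W n w ^+ r * \1_(Z n @^-1` [set i]) w].

(** Laplace-Stieltjes transform, at real arguments. *)
Definition lst (nu : probability R R) (s : R) : R :=
  \int[nu]_(t in `[0, +oo[) expR (- s * t).

(** In [v1] and [vm1], [Phi] is evaluated at real points only, where its
    values are real numbers; hence the use of [Re]. *)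
Variables (pi : 'cV[R]_N) (Phi : 'I_N -> R[i] -> R[i]).

Definition v1 (j : 'I_N) : R :=
  p * \sum_i P i j * lst (B i) (lam 0 j) * complex.Re (Phi i (lam 0 j)%:C).

Definition vm1 (j : 'I_N) : R :=
  (1 - p) * (pi j 0 -
    \sum_i P i j * lst (C i) (mu 0 j) * complex.Re (Phi i (mu 0 j)%:C)).

Definition k1 : 'rV[R]_N := \row_j
  ((1 - p) * pi j 0 * mu 0 j + mu 0 j * v1 j - lam 0 j * vm1 j).

Definition k2 : 'rV[R]_N := \row_j (v1 j + vm1 j).

End Model.

(* Main.v *)
(** Given the states [i], [j] of the background chain at times [n], [n+1], the
    variables [W n], [S n] and [A n.+1] are independent, the last one being
    exponential of rate [lam j]; the same holds for [W n], [Cn n], [D n.+1] and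
    [mu j].  For [X >= 0] and [r > 0], integration by parts gives
    [h_r = X^r - (r / lam) h_(r-1)] for [h_r = E ((X - A)^+)^r], where [h_0] is
    to be read as [1 - exp (- lam X)], and [E ((D - X)^+)^r] equals
    [r! / mu^r * exp (- mu X)].  With [X = W n + S n] resp. [X = W n + Cn n]
    the moments of [W n.+1] are thus expressed through those of [W n] and the
    transforms at [lam j] and [mu j]; eliminating [h_r] from the limits of two
    consecutive relations yields the recursion. *)

Require Import Defs.
From HB Require Import structures.
From mathcomp Require Import all_boot all_order all_algebra.
From mathcomp Require Import complex.
From mathcomp Require Import all_classical all_reals all_analysis.
From mathcomp Require Import measurable_realfun ring lra.

Set Implicit Arguments.
Unset Strict Implicit.
Unset Printing Implicit Defensive.

Import Order.TTheory GRing.Theory Num.Theory.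
Import numFieldNormedType.Exports.
Local Open Scope classical_set_scope.
Local Open Scope ring_scope.

(** * The exponential distribution *)

(** The obstacle is finiteness. Convergence to a finite limit makes the moments of [W n] finite only
    for large [n], and the overflow moments $h_r$ come with no bound at all. The one-step identities
    are therefore proved in [\bar R], for nonnegative integrands and without subtraction; real
    equations are read off for large [n], and convergence of the overflow terms is derived by
    induction on [r].

    The law of a step is put as a product formula on the event that [V n = v], [Z n = i] and
    [Z n.+1 = j], for unnormalised measures, so that null events need no separate treatment in the
    integrals.

    Origin of the constants: $k_{j,2}$ is the limit of $P(W_{n+1} = 0, Z_{n+1} = j)$. The order-0
    analogues of the overflow and overshoot moments only count the mass where $W_{n+1} > 0$. Hence
    in the second moment $\tilde m_0 - \tilde k_2$ takes the place of $\tilde m_0$ at the summand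
    $I$, while $\tilde k_1$ collects the same order-0 terms with weights $\mu_j$ and $\lambda_j$.
    From order 3 on they no longer occur.

    That $\tilde m_0 = \tilde\pi^T$ is derived: the limit is an invariant vector of total mass 1,
    and irreducibility makes it unique. *)

Section density.
Context d (T : measurableType d) (R : realType).
Local Open Scope ereal_scope.

Import HBNNSimple.

(** True for indicators by [nuE], hence for simple functions, hence in general by monotone
    convergence. It serves both for the exponential density and for the density [\1_E] of [Pr]
    restricted to an event. *)
Lemma ge0_integral_density (mu nu : {measure set T -> \bar R}) (g : T -> R)
    (f : T -> \bar R) :
  measurable_fun setT g -> (forall x, 0 <= g x)%R ->
  (forall A, measurable A -> nu A = \int[mu]_(x in A) (g x)%:E) ->
  measurable_fun setT f -> (forall x, 0 <= f x) ->
  \int[nu]_x f x = \int[mu]_x (f x * (g x)%:E).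
Proof.
move=> mg g0 nuE mf f0; pose f_ := nnsfun_approx measurableT mf.
have mgE : measurable_fun setT (EFin \o g) by exact/measurable_EFinP.
have fcvg x : (f_ n x)%:E @[n --> \oo] --> f x by exact: cvg_nnsfun_approx.
have simple (h : {nnsfun T >-> R}) :
    \int[nu]_x (h x)%:E = \int[mu]_x ((h x)%:E * (g x)%:E).
  under eq_integral do rewrite fimfunE -fsumEFin//.
  rewrite ge0_integral_fsum//; last 2 first.
  - by move=> y; exact/measurable_EFinP/measurable_funM.
  - by move=> y x _; rewrite nnfun_muleindic_ge0.
  have sumE x : (h x)%:E * (g x)%:E = \sum_(r \in range h)
      (r * \1_(h @^-1` [set r]) x)%:E * (g x)%:E.
    rewrite -ge0_mule_fsuml; last by move=> r; rewrite nnfun_muleindic_ge0.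
    by rewrite fsumEFin// {1}(fimfunE h).
  under [RHS]eq_integral do rewrite sumE.
  rewrite ge0_integral_fsum//; last 2 first.
  - move=> y; apply: emeasurable_funM => //.
    exact/measurable_EFinP/measurable_funM.
  - by move=> y x _; rewrite mule_ge0// ?nnfun_muleindic_ge0// lee_fin.
  apply: eq_fsbigr => r /[!inE] -[t _ <-].
  rewrite integralZl_indic_nnsfun// integral_indic// setIT nuE//.
  under [RHS]eq_integral do rewrite EFinM -muleA.
  rewrite ge0_integralZl//; last 3 first.
  - by apply: emeasurable_funM => //; exact/measurable_EFinP.
  - by move=> x _; rewrite mule_ge0// lee_fin.
  - by rewrite lee_fin.
  congr (_ * _); rewrite [LHS]integral_mkcond; apply: eq_integral => x _.
  by rewrite patchE indicE; case: ifPn => _; rewrite ?mul1e ?mul0e.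
transitivity (limn (fun n => \int[nu]_x (f_ n x)%:E)).
  rewrite -monotone_convergence//=.
  - by apply: eq_integral => x _; exact/esym/cvg_lim.
  - by move=> n; exact/measurable_EFinP.
  - by move=> n x _; rewrite lee_fin.
  - by move=> x _ a b ab; rewrite lee_fin; exact/lefP/nd_nnsfun_approx.
under eq_fun do rewrite simple.
rewrite -monotone_convergence//=.
- apply: eq_integral => x _; apply/cvg_lim => //.
  by apply: cvgeZr => //; exact: fcvg.
- by move=> n; apply: emeasurable_funM => //; exact/measurable_EFinP.
- by move=> n x _; rewrite mule_ge0 ?lee_fin.
- move=> x _ a b ab; rewrite lee_wpmul2r ?lee_fin//.
  exact/lefP/nd_nnsfun_approx.
Qed.

End density.

Section exponential.
Context {R : realType}.
Implicit Types (l x : R).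

Let idR : measurableTypeR R -> R := idfun.

#[local] HB.instance Definition _ :=
  @isMeasurableFun.Build _ _ _ _ idR (@measurable_id _ _ setT).

Let exponential_measurableTypeR l (l0 : 0 < l) :
    probability (measurableTypeR R) R :=
  exponential_distribution_exponential_prob__canonical__probability_measure_Probability l0.

(** [exponential_prob] is a measure on [measurableTypeR R], whose display
    differs from the one of [R]; this is its transport to [R]. *)
Definition exponential l (l0 : 0 < l) : probability R R :=
  distribution (exponential_measurableTypeR l0) idR.

Lemma ge0_integral_exponential l (l0 : 0 < l) (f : R -> \bar R) :
  measurable_fun setT f -> (forall x, 0 <= f x)%E ->
  (\int[exponential l0]_x f x =
   \int[lebesgue_measure]_(x in `[0%R, +oo[) (f x * (l * expR (- l * x))%:E))%E.
Proof.
move=> mf f0.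
rewrite /exponential ge0_integral_distribution//.
rewrite (@ge0_integral_density _ _ _ (@lebesgue_measure R)
   (exponential_measurableTypeR l0) (exponential_pdf l))//.
- rewrite [RHS]integral_mkcond; apply: eq_integral => x _.
  rewrite /exponential_pdf !patchE; case: ifPn => //.
  by rewrite mule0.
- exact: measurable_exponential_pdf.
- by move=> x; apply: exponential_pdf_ge0; exact: ltW.
Qed.

Lemma exponential_ray l (l0 : 0 < l) x :
  exponential l0 `]-oo, x]%classic = (if 0 <= x then 1 - expR (- l * x) else 0)%:E.
Proof.
have -> : exponential l0 `]-oo, x]%classic =
   (\int[lebesgue_measure]_(y in `[0%R, x]) (exponential_pdf l y)%:E)%E.
  (* The transport along the identity is convertible to the original measure, preimages under [idR]
     being the sets themselves. *)
  rewrite -[LHS]/(exponential_prob l `]-oo, x]%classic).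
  rewrite /exponential_prob integral_mkcond [RHS]integral_mkcond.
  apply: eq_integral => y _; rewrite !patchE !mem_setE !in_itv/=.
  by case: (leP 0 y) => y0 //=; case: ifP => // _; rewrite lt0_exponential_pdf.
case: (ltgtP 0 x) => x0.
- by rewrite -[LHS]/(exponential_prob l `[0, x]%classic) exponential_prob_itv0c.
- by rewrite set_itv_ge ?integral_set0// bnd_simp -ltNge.
- by rewrite -x0 set_itv1 integral_set1 mulr0 expR0 subrr.
Qed.

End exponential.

(** * Integrals of powers against an exponential *)

Section calculus.
Context {R : realType}.
Implicit Types (l x u : R) (r : nat).
Local Notation mu := (@lebesgue_measure R).

Lemma is_derive_continuous (f f' : R -> R) :
  (forall x, is_derive x 1 f (f' x)) -> continuous f.
Proof.
by move=> df x; apply/differentiable_continuous/derivable1_diffP; exact: ex_derive.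
Qed.

Lemma integral_itvcc_derive (f F : R -> R) (a b : R) : a <= b ->
  continuous f -> (forall x, is_derive x 1 F (f x)) ->
  (\int[mu]_(x in `[a, b]) (f x)%:E = (F b - F a)%:E)%E.
Proof.
rewrite le_eqVlt => /predU1P[->|ab] cf dF.
  by rewrite set_itv1 integral_set1 subrr.
have cF := is_derive_continuous dF.
rewrite (@continuous_FTC2 _ f F) ?EFinB//.
- exact: continuous_subspaceT.
- split; first by move=> x _; exact: ex_derive.
  + exact/cvg_at_right_filter/cF.
  + exact/cvg_at_left_filter/cF.
- by move=> x _; rewrite derive1E; exact: derive_val.
Qed.

Lemma is_derive_expRM l x :
  is_derive x 1 (fun y => expR (- l * y)) (- l * expR (- l * x)).
Proof.
have h : is_derive x 1 (fun y : R => - l * y) (- l).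
  have := @is_deriveZ _ _ _ (@id R) (- l) x 1 1 (is_derive_id _ _).
  by rewrite /GRing.scale/= mulr1.
have := is_derive1_comp (is_derive_expR (- l * x)) h.
by rewrite mulrC.
Qed.

Lemma is_derive_XexpR l u r x :
  is_derive x 1 (fun y => (y - u) ^+ r.+1 * expR (- l * y))
    (r.+1%:R * (x - u) ^+ r * expR (- l * x)
     - l * ((x - u) ^+ r.+1 * expR (- l * x))).
Proof.
have h1 : is_derive x 1 (fun y : R => y - u) 1.
  have := @is_deriveB _ _ _ (@id R) (cst u) x 1 1 0 (is_derive_id _ _)
    (is_derive_cst _ _ _).
  by rewrite subr0.
have h2 := is_deriveM (is_deriveX r.+1 h1) (is_derive_expRM l x).
have fE : (fun y : R => y - u) ^+ r.+1 = (fun y => (y - u) ^+ r.+1).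
  by apply/funext => y; rewrite exprfctE.
rewrite fE in h2; apply: (is_derive_eq h2).
by rewrite /GRing.scale/=; ring.
Qed.

(** The integral of $(x-a)^r e^{-la}$ over $[0,x]$, solved by parts; [l * truncated_moment l r x] is
    the $h_r$ of the overview at $X = x$, including the special reading of $h_0$. With the
    recurrence as definition, relations between orders hold pointwise by algebra. *)
Fixpoint truncated_moment l r x : R :=
  if r is s.+1 then (x ^+ s.+1 - s.+1%:R * truncated_moment l s x) / l
  else (1 - expR (- l * x)) / l.

Lemma measurable_truncated_moment l r :
  measurable_fun setT (truncated_moment l r).
Proof.
elim: r => [|r IHr] /=.
  apply: measurable_funM => //; apply: measurable_funB => //.
  by apply: measurableT_comp => //; exact: measurable_funM.
apply: measurable_funM => //; apply: measurable_funB => //.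
exact: measurable_funM.
Qed.

(** The derivative of $-(x-a)^{r+1}e^{-la}$ in $a$ is a combination of the integrands of orders
    $r+1$ and $r$ with positive coefficients, so integrating it expresses one integral through the
    other. *)
Lemma integral_truncated_moment l r x : 0 < l -> 0 <= x ->
  (\int[mu]_(a in `[0%R, x]) ((x - a) ^+ r * expR (- l * a))%:E =
   (truncated_moment l r x)%:E)%E.
Proof.
move=> l0 x0; elim: r => [|r IHr] /=.
  under eq_integral do rewrite expr0 mul1r.
  have dF (a : R) : is_derive a 1
      (fun a => (- l^-1) * expR (- l * a)) (expR (- l * a)).
    have h := is_deriveZ (- l^-1) (is_derive_expRM l a).
    apply: (is_derive_eq h).
    by rewrite /GRing.scale/= mulrA mulrNN mulVf ?gt_eqF// mul1r.
  rewrite (integral_itvcc_derive x0 (is_derive_continuous (is_derive_expRM l)) dF).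
  by congr EFin; rewrite mulr0 expR0; field; rewrite gt_eqF.
have cX s : continuous (fun a => (x - a) ^+ s * expR (- l * a)).
  move=> a; apply: cvgM.
    by apply: (@cvg_comp _ _ _ (fun a => x - a) (fun a => a ^+ s));
      last exact: exprn_continuous; apply: cvgB => //; exact: cvg_cst.
  exact: (is_derive_continuous (is_derive_expRM l)).
have mX s : measurable_fun `[0, x] (fun a => ((x - a) ^+ s * expR (- l * a))%:E).
  apply/measurable_EFinP; apply: measurable_funTS.
  exact: continuous_measurable_fun.
have X0 s a : `[0, x]%classic a -> (0 <= ((x - a) ^+ s * expR (- l * a))%:E)%E.
  rewrite /= in_itv/= => /andP[_ ax].
  by rewrite lee_fin mulr_ge0// ?expR_ge0// exprn_ge0// subr_ge0.
have : (\int[mu]_(a in `[0%R, x]) (l%:E * ((x - a) ^+ r.+1 * expR (- l * a))%:E +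
    r.+1%:R%:E * ((x - a) ^+ r * expR (- l * a))%:E) = (x ^+ r.+1)%:E)%E.
  (* This is $-(x-a)^{r+1}e^{-la}$; the sign power turns $x-a$ into $a-x$, the form that
     [is_derive_XexpR] handles. *)
  pose F := fun a => - ((-1) ^+ r.+1 * ((a - x) ^+ r.+1 * expR (- l * a))).
  rewrite (_ : x ^+ r.+1 = F x - F 0); last first.
    rewrite /F subrr expr0n/= mul0r mulr0 oppr0 sub0r opprK mulr0 expR0 mulr1.
    by rewrite sub0r -exprMn mulrNN mul1r.
  under eq_integral do rewrite -!EFinM -EFinD.
  have dF (a : R) : is_derive a 1 F (l * ((x - a) ^+ r.+1 * expR (- l * a)) +
      r.+1%:R * ((x - a) ^+ r * expR (- l * a))).
    have h := is_deriveN (is_deriveZ ((-1) ^+ r.+1) (is_derive_XexpR l x r a)).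
    apply: (is_derive_eq h); rewrite /GRing.scale/=.
    rewrite -(opprB a x) (exprNn (a - x) r) (exprNn (a - x) r.+1).
    by rewrite (exprS (-1)); ring.
  rewrite (integral_itvcc_derive x0 _ dF)//.
  by move=> a; apply: cvgD; (apply: cvgM; [exact: cvg_cst|exact: cX]).
rewrite ge0_integralD//=; last 4 first.
- by move=> a ax; apply: mule_ge0; [rewrite lee_fin ltW|exact: X0].
- by apply: emeasurable_funM => //; exact: mX.
- by move=> a ax; apply: mule_ge0; [rewrite lee_fin|exact: X0].
- by apply: emeasurable_funM => //; exact: mX.
rewrite !ge0_integralZl//; do ?[exact: X0 | exact: mX | by rewrite lee_fin ?ltW].
rewrite IHr; set I := (\int[mu]_(a in _) _)%E.
have : (0 <= I)%E by apply: integral_ge0; exact: X0.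
(* An infinite [I] would make the left-hand side infinite, whereas it equals [x ^+ r.+1]; so [I] is
   real and the equation can be solved for it. *)
case: I => [i| |] //= _; last by rewrite gt0_muley ?lte_fin.
rewrite -!EFinM -EFinD => -[<-]; congr EFin; field.
by rewrite gt_eqF.
Qed.

Lemma truncated_moment_ge0 l r x : 0 < l -> 0 <= x ->
  0 <= truncated_moment l r x.
Proof.
move=> l0 x0; rewrite -lee_fin -integral_truncated_moment//.
apply: integral_ge0 => a; rewrite /= in_itv/= => /andP[_ ax].
by rewrite lee_fin mulr_ge0// ?expR_ge0// exprn_ge0// subr_ge0.
Qed.

Lemma cvg_XexpR l u r : 0 < l ->
  (y - u) ^+ r * expR (- l * y) @[y --> +oo] --> 0.
Proof.
(* With $t = l(y-u)$, the bound $e^t \ge t^{r+1}/(r+1)!$ dominates the function by $c/(y-u)$; the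
   factor [expR (- l * u)] in [c] comes from $e^{-ly} = e^{-t}e^{-lu}$. *)
move=> l0; pose c := expR (- l * u) * (r.+1)`!%:R / l ^+ r.+1.
apply: (@squeeze_cvgr _ _ _ _ (cst 0) (fun y => c * (y - u)^-1)).
- near=> y; have yu : 0 < y - u.
    rewrite subr_gt0; near: y.
    by apply: nbhs_pinfty_gt; exact: num_real.
  rewrite mulr_ge0 ?exprn_ge0 ?expR_ge0 ?(ltW yu)//=.
  have lyu : 0 < l * (y - u) by rewrite mulr_gt0.
  have := expR_ge1Dxn r (ltW lyu).
  set f := (r.+1)`!%:R; have f0 : 0 < f by rewrite ltr0n fact_gt0.
  move=> h; have {}h : (l * (y - u)) ^+ r.+1 / f <= expR (l * (y - u)) by lra.
  rewrite (_ : - l * y = - (l * (y - u)) + - l * u); last by ring.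
  rewrite expRD expRN /c -/f.
  have -> : expR (- l * u) * f / l ^+ r.+1 / (y - u) =
     (y - u) ^+ r * (((l * (y - u)) ^+ r.+1 / f)^-1 * expR (- l * u)).
    rewrite exprMn (exprS (y - u)); field; rewrite !gt_eqF//= ?exprn_gt0//.
  rewrite ler_wpM2l ?exprn_ge0 ?(ltW yu)// ler_wpM2r ?expR_ge0//.
  by rewrite lef_pV2 ?posrE ?expR_gt0// divr_gt0// exprn_gt0.
- exact: cvg_cst.
- rewrite -[X in _ --> X](mulr0 c); apply: cvgM; first exact: cvg_cst.
  apply/gtr0_cvgV0.
    near=> y; rewrite subr_gt0; near: y.
    by apply: nbhs_pinfty_gt; exact: num_real.
  exact: cvg_addrr.
Unshelve. all: by end_near. Qed.

End calculus.

Section overshoot.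
Context {R : realType}.
Variables (l : R) (l0 : 0 < l).
Local Notation mu := (@lebesgue_measure R).

Let measurable_maxX (f : R -> R) r : measurable_fun setT f ->
  measurable_fun setT (fun y => (Num.max (f y) 0 ^+ r)%:E).
Proof.
move=> mf; apply/measurable_EFinP/measurable_funX.
exact: measurable_maxr.
Qed.

(** The exponent is a successor because the integrand has to vanish for $a > x$, where exponent 0
    would give 1. *)
Lemma integral_exponential_maxBl r x : 0 <= x ->
  (\int[exponential l0]_a (Num.max (x - a) 0 ^+ r.+1)%:E =
   (l * truncated_moment l r.+1 x)%:E)%E.
Proof.
move=> x0; rewrite ge0_integral_exponential; last 2 first.
- by apply: measurable_maxX; exact: measurable_funB.
- by move=> a; rewrite lee_fin exprn_ge0// le_max lexx orbT.
rewrite EFinM -integral_truncated_moment//.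
rewrite -ge0_integralZl//; last 3 first.
- apply/measurable_EFinP; apply: measurable_funTS; apply: measurable_funM.
    by apply: measurable_funX; exact: measurable_funB.
  by apply: measurableT_comp => //; exact: measurable_funM.
- move=> a; rewrite /= in_itv/= => /andP[_ ax].
  by rewrite lee_fin mulr_ge0// ?expR_ge0// exprn_ge0// subr_ge0.
- by rewrite lee_fin ltW.
rewrite [LHS]integral_mkcond [RHS]integral_mkcond; apply: eq_integral => a _.
rewrite !patchE !mem_setE !in_itv/= andbT; case: (leP 0 a) => //= a0.
case: (leP a x) => ax.
  by rewrite max_l ?subr_ge0// -!EFinM; congr EFin; ring.
by rewrite max_r ?subr_le0 1?ltW// expr0n/= mul0e.
Qed.

(** The antiderivative of $(y-u)^r\, l e^{-ly}$ that tends to 0 at infinity, obtained by repeated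
    integration by parts; minus its value at [u] is the integral over $[u,\infty)$. *)
Fixpoint overshoot_primitive u r y : R :=
  if r is s.+1 then
    - ((y - u) ^+ s.+1 * expR (- l * y)) + s.+1%:R / l * overshoot_primitive u s y
  else - expR (- l * y).

Lemma is_derive_overshoot_primitive (u : R) r (y : R) :
  is_derive y 1 (overshoot_primitive u r) ((y - u) ^+ r * (l * expR (- l * y))).
Proof.
elim: r => [|r IHr] /=.
  have h := is_deriveN (is_derive_expRM l y).
  by apply: (is_derive_eq h); ring.
have h := is_deriveD (is_deriveN (is_derive_XexpR l u r y))
  (is_deriveZ (r.+1%:R / l) IHr).
by apply: (is_derive_eq h); rewrite /GRing.scale/=; field; rewrite gt_eqF.
Qed.

Lemma overshoot_primitive_start u r :
  overshoot_primitive u r u = - (r`!%:R / l ^+ r * expR (- l * u)).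
Proof.
elim: r => [|r IHr] /=; first by rewrite fact0 expr0 divr1 mul1r.
rewrite IHr subrr expr0n/= mul0r oppr0 add0r factS natrM exprS.
by field; rewrite expf_neq0 gt_eqF.
Qed.

Lemma cvg_overshoot_primitive (u : R) r :
  overshoot_primitive u r y @[y --> +oo] --> 0.
Proof.
elim: r => [|r IHr] /=.
  rewrite -oppr0; apply: cvgN; have := cvg_XexpR 0 0 l0.
  by under eq_fun do rewrite expr0 mul1r.
have h := cvgD (cvgN (cvg_XexpR u r.+1 l0)) (cvgM (cvg_cst (r.+1%:R / l)) IHr).
by rewrite mulr0 oppr0 addr0 in h; exact: h.
Qed.

Lemma integral_exponential_maxBr r u : 0 <= u ->
  (\int[exponential l0]_y (Num.max (y - u) 0 ^+ r.+1)%:E =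
   ((r.+1)`!%:R / l ^+ r.+1 * expR (- l * u))%:E)%E.
Proof.
move=> u0; rewrite ge0_integral_exponential; last 2 first.
- by apply: measurable_maxX; exact: measurable_funB.
- by move=> a; rewrite lee_fin exprn_ge0// le_max lexx orbT.
have dF := is_derive_overshoot_primitive u r.+1.
have cF := is_derive_continuous dF.
transitivity (\int[mu]_(y in `[u, +oo[)
    ((y - u) ^+ r.+1 * (l * expR (- l * y)))%:E)%E.
  rewrite [LHS]integral_mkcond [RHS]integral_mkcond; apply: eq_integral => y _.
  rewrite !patchE !mem_setE !in_itv/= !andbT.
  case: (leP u y) => uy.
    by rewrite (le_trans u0 uy) max_l ?subr_ge0// -EFinM.
  by case: ifP => // _; rewrite max_r ?subr_le0 1?ltW// expr0n/= mul0e.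
rewrite (@ge0_continuous_FTC2y _ _ (overshoot_primitive u r.+1) u 0).
- by rewrite overshoot_primitive_start sub0e -EFinN opprK.
- move=> y uy; rewrite mulr_ge0 ?exprn_ge0 ?subr_ge0//.
  by rewrite mulr_ge0 ?expR_ge0// ltW.
- apply: continuous_subspaceT => y.
  under eq_fun do rewrite mulrCA.
  exact: (cvgM (cvg_cst l) (is_derive_continuous (is_derive_XexpR l u r) (x := y))).
- exact: cvg_overshoot_primitive.
- by move=> y _; exact: ex_derive.
- exact/cvg_at_right_filter/cF.
- by move=> y _; rewrite derive1E; exact: derive_val.
Qed.

End overshoot.

(** * Independence and integration *)

Section law_on.
Context d d' (T : measurableType d) (T1 : measurableType d') (R : realType).
Variables (Pr : probability T R) (E : set T) (X : T -> T1).
Local Open Scope ereal_scope.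

(** An unnormalised conditional law, of total mass [Pr E]. The measurability proofs are arguments so
    that a finite measure structure can be attached to it. *)
Definition law_on of measurable E & measurable_fun setT X : set T1 -> \bar R :=
  fun A => Pr (E `&` X @^-1` A).

Variables (mE : measurable E) (mX : measurable_fun setT X).

Lemma measurable_preimage A : measurable A -> measurable (X @^-1` A).
Proof. by move=> mA; rewrite -[X in measurable X]setTI; exact: mX. Qed.

Let law_on0 : law_on mE mX set0 = 0.
Proof. by rewrite /law_on preimage_set0 setI0 measure0. Qed.

Let law_on_ge0 A : 0 <= law_on mE mX A.
Proof. exact: measure_ge0. Qed.

Let law_on_sigma_additive : semi_sigma_additive (law_on mE mX).
Proof.
move=> F mF tF mUF; rewrite /law_on preimage_bigcup setI_bigcupr.
apply: measure_semi_sigma_additive.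
- by move=> n; apply: measurableI => //; exact: measurable_preimage.
- apply/trivIsetP => /= i j _ _ ij; rewrite setIACA -preimage_setI.
  by move/trivIsetP : tF => /(_ _ _ _ _ ij) ->//; rewrite preimage_set0 setI0.
- rewrite -setI_bigcupr -preimage_bigcup; apply: measurableI => //.
  exact: measurable_preimage.
Qed.

HB.instance Definition _ := isMeasure.Build _ _ _ (law_on mE mX)
  law_on0 law_on_ge0 law_on_sigma_additive.

Let law_on_fin : fin_num_fun (law_on mE mX).
Proof.
move=> A mA; apply: fin_num_measure; apply: measurableI => //.
exact: measurable_preimage.
Qed.

HB.instance Definition _ := Measure_isFinite.Build _ _ _ (law_on mE mX) law_on_fin.

Lemma ge0_integral_law_on (f : T1 -> \bar R) :
  measurable_fun setT f -> (forall x, 0 <= f x) ->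
  \int[law_on mE mX]_y f y = \int[Pr]_(w in E) f (X w).
Proof.
move=> mf f0.
have mfX : measurable_fun setT (f \o X) by exact: measurableT_comp.
transitivity (\int[pushforward (mrestr Pr mE) X]_y f y).
  apply: eq_measure_integral => A mA _.
  by rewrite /law_on /= /pushforward /mrestr setIC.
rewrite ge0_integral_pushforward// preimage_setT.
rewrite (@ge0_integral_density _ _ _ Pr _ (\1_E))//.
- rewrite [RHS]integral_mkcond; apply: eq_integral => w _.
  by rewrite patchE indicE; case: ifPn => _; rewrite ?mule1 ?mule0.
- by move=> A mA; rewrite integral_indic// setIC.
- by move=> w; exact: f0.
Qed.

End law_on.

Section rays.
Context {R : realType}.
Local Open Scope ereal_scope.

(** Differences of rays are the intervals $]a,b]$, which generate the Borel sets and are stable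
    under intersection. Finiteness of [m1] permits the subtraction; on rays [m2] inherits it. *)
Lemma measure_ray_unique (m1 m2 : {measure set R -> \bar R}) :
  (m1 setT < +oo) -> (forall x : R, m1 `]-oo, x]%classic = m2 `]-oo, x]%classic) ->
  forall A, measurable A -> m1 A = m2 A.
Proof.
move=> m1oo m12 A mA.
have m1fin B : measurable B -> m1 B < +oo.
  by move=> mB; rewrite (le_lt_trans _ m1oo)// le_measure// inE.
have ocE (a b : R) : (a < b)%R ->
    `]a, b]%classic = `]-oo, b]%classic `\` `]-oo, a]%classic.
  move=> ab; apply/seteqP; split => x /=; rewrite !in_itv/=.
    by move=> /andP[ax ->]; split=> //; rewrite leNgt ax.
  by move=> [-> /negP]; rewrite -ltNge => ->.
have rayI (a b : R) : (a < b)%R ->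
    `]-oo, b]%classic `&` `]-oo, a]%classic = `]-oo, a]%classic :> set R.
  move=> ab; apply/setIidPr => x /=; rewrite !in_itv/= => /le_trans; apply.
  exact: ltW.
apply: (@measure_unique _ _ R (@ocitv R) (fun n => `](- n%:R)%R, n%:R]%classic)) => //.
- exact: ocitvI.
- by move=> n; exact: is_ocitv.
- rewrite -subTset => x _; exists (Num.truncn `|x|).+1 => //=.
  have : (`|x| < (Num.truncn `|x|).+1%:R)%R by exact: truncnS_gt.
  by rewrite in_itv/= ltr_norml => /andP[-> /ltW->].
- move=> B /ocitvP[->|[[a b]/= ab ->]]; first by rewrite !measure0.
  have m2fin : m2 `]-oo, b]%classic < +oo by rewrite -m12; exact: m1fin.
  rewrite ocE// !measureD ?rayI//; last exact: m1fin.
  by congr (_ - _); exact: m12.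
- by move=> n; exact: m1fin.
Qed.

Lemma scaled_ray_unique d (T : measurableType d) (Pr : probability T R)
    (E : set T) (X : T -> R) (nu : probability R R) (k : R) :
  measurable E -> measurable_fun setT X -> (0 <= k)%R ->
  (forall x : R, Pr (E `&` X @^-1` `]-oo, x]%classic) = k%:E * nu `]-oo, x]%classic) ->
  forall A, measurable A -> Pr (E `&` X @^-1` A) = k%:E * nu A.
Proof.
move=> mE mX k0 PE A mA.
apply: (@measure_ray_unique (law_on Pr mE mX) (mscale (NngNum k0) nu)) => //.
by rewrite -ge0_fin_numE// fin_num_measure.
Qed.

End rays.

Section independence.
Context d d1 d2 (T : measurableType d) (T1 : measurableType d1)
  (T2 : measurableType d2) (R : realType).
Variables (Pr : probability T R) (E : set T) (X : T -> T1) (Y : T -> T2).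
Variable nu : probability T2 R.
Hypotheses (mE : measurable E).
Hypotheses (mX : measurable_fun setT X) (mY : measurable_fun setT Y).
Local Open Scope ereal_scope.

(** The joint law of [X] and [Y] on [E] is the product of [law_on Pr mE mX] and [nu], both agreeing
    on rectangles; Tonelli then integrates [Y] out of any nonnegative [f]. *)
Lemma ge0_integral_indep :
  (forall A B, measurable A -> measurable B ->
    Pr (E `&` (X @^-1` A `&` Y @^-1` B)) = Pr (E `&` X @^-1` A) * nu B) ->
  forall f : T1 * T2 -> \bar R, measurable_fun setT f -> (forall x, 0 <= f x) ->
  \int[Pr]_(w in E) f (X w, Y w) = \int[Pr]_(w in E) \int[nu]_y f (X w, y).
Proof.
move=> indepXY f mf f0.
have mXY : measurable_fun setT (fun w => (X w, Y w)) by exact: measurable_fun_pair.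
rewrite -(ge0_integral_law_on Pr mE mXY mf f0).
transitivity (\int[law_on Pr mE mX \x nu]_z f z).
  apply: eq_measure_integral => A mA _; apply/esym.
  apply: (@product_measure_unique _ _ _ _ _ (law_on Pr mE mX) nu) => //.
rewrite fubini_tonelli1//.
rewrite (ge0_integral_law_on Pr mE mX)//.
- exact: measurable_fun_fubini_tonelli_F.
- by move=> x; exact: integral_ge0.
Qed.

End independence.

Section rectangles.
Context d d1 d2 (T : measurableType d) (T1 : measurableType d1)
  (T2 : measurableType d2) (R : realType).
Variables (Pr : probability T R) (E F : set T) (X : T -> T1) (Y : T -> T2).
Hypotheses (mE : measurable E) (mF : measurable F).
Hypotheses (mX : measurable_fun setT X) (mY : measurable_fun setT Y).
Local Open Scope ereal_scope.

(** Rectangles are stable under intersection and generate the product sigma-algebra, so two finite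
    measures on the product agree once they agree on them. *)
Lemma scaled_rectangle_unique (k : R) : (0 <= k)%R ->
  (forall A B, measurable A -> measurable B ->
    Pr (E `&` (X @^-1` A `&` Y @^-1` B)) =
    k%:E * Pr (F `&` (X @^-1` A `&` Y @^-1` B))) ->
  forall C, measurable C -> Pr (E `&` (fun w => (X w, Y w)) @^-1` C) =
    k%:E * Pr (F `&` (fun w => (X w, Y w)) @^-1` C).
Proof.
move=> k0 PEF C mC.
have mXY : measurable_fun setT (fun w => (X w, Y w)) by exact: measurable_fun_pair.
pose G := [set A `*` B | A in @measurable _ T1 & B in @measurable _ T2].
apply: (@measure_unique _ _ _ G (fun=> setT) _ _ _ _
  (law_on Pr mE mXY) (mscale (NngNum k0) (law_on Pr mF mXY))) => //.
- exact: measurable_prod_measurableType.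
- move=> _ _ [A1 mA1 [B1 mB1 <-]] [A2 mA2 [B2 mB2 <-]].
  exists (A1 `&` A2); first exact: measurableI.
  by exists (B1 `&` B2); [exact: measurableI|rewrite setXI].
- by move=> _; exists setT => //; exists setT => //; rewrite setXTT.
- by rewrite bigcup_const.
- by move=> _ [A mA [B mB <-]]; exact: PEF.
- by move=> _; rewrite -ge0_fin_numE// fin_num_measure.
Qed.

End rectangles.

(** * One step of the recursion on a fixed transition *)

Section one_step.
Context d (T : measurableType d) (R : realType).
Variables (Pr : probability T R) (E F : set T) (W X Y : T -> R).
Variables (nu : probability R R) (c l : R) (l0 : 0 < l).
Hypotheses (mE : measurable E) (mF : measurable F).
Hypotheses (mW : measurable_fun setT W) (mX : measurable_fun setT X).
Hypotheses (mY : measurable_fun setT Y).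
Hypotheses (W0 : forall w, 0 <= W w) (X0 : forall w, 0 <= X w).
Hypotheses (c0 : 0 <= c) (nu0 : nu `[0%R, +oo[%classic = 1%E).
Local Open Scope ereal_scope.
(** In the application [E] fixes [V n] and the states at times [n] and [n.+1], [F] fixes only the
    state at time [n], and [c] is [P i j] times the probability of the value of [V n]. The pair
    ([X], [Y]) is either ([S n], [A n.+1]) or ([Cn n], [D n.+1]), so upward and downward steps share
    this section. *)
Hypothesis lawE : forall U K L, measurable U -> measurable K -> measurable L ->
  Pr (E `&` (W @^-1` U `&` X @^-1` K `&` Y @^-1` L)) =
  c%:E * Pr (F `&` W @^-1` U) * nu K * exponential l0 L.

Lemma integral_nonneg_support (f : R -> \bar R) :
  measurable_fun setT f -> (forall x, 0 <= f x) ->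
  \int[nu]_x f x = \int[nu]_(x in `[0%R, +oo[) f x.
Proof.
move=> mf f0.
rewrite (@ge0_negligible_integral _ _ _ nu setT (~` `[0%R, +oo[%classic))//.
- by rewrite setTD setCK.
- exact: measurableC.
- by have := probability_setC nu (measurable_itv `[0%R, +oo[); rewrite nu0 subee.
Qed.

Let lawE2 U K : measurable U -> measurable K ->
  Pr (E `&` (W @^-1` U `&` X @^-1` K)) = c%:E * Pr (F `&` W @^-1` U) * nu K.
Proof.
move=> mU mK; have := lawE mU mK measurableT.
by rewrite preimage_setT setIT probability_setT mule1.
Qed.

Let lawE1 U : measurable U ->
  Pr (E `&` W @^-1` U) = c%:E * Pr (F `&` W @^-1` U).
Proof.
move=> mU; have := lawE2 mU measurableT.
by rewrite preimage_setT setIT probability_setT mule1.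
Qed.

Lemma ge0_integral_service (f : R * R -> \bar R) :
  measurable_fun setT f -> (forall z, 0 <= f z) ->
  \int[Pr]_(w in E) f (W w + X w, Y w)%R =
  \int[Pr]_(w in E) \int[exponential l0]_y f (W w + X w, y)%R.
Proof.
move=> mf f0.
have mWX : measurable_fun setT (fun w => (W w, X w)) by exact: measurable_fun_pair.
have mf' : measurable_fun setT (fun z : R * R * R => f (z.1.1 + z.1.2, z.2)%R).
  apply: (measurableT_comp mf); apply: measurable_fun_pair => //.
  by apply: measurable_funD; apply: measurableT_comp.
apply: (@ge0_integral_indep _ _ _ _ _ _ R Pr E (fun w => (W w, X w)) Y
  (exponential l0) mE mWX mY _ _ mf') => //.
(* For fixed [B] both sides are measures in the planar set [A], with [exponential l0 B] as scaling
   factor; [lawE] compares them on rectangles, which suffices. *)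
move=> A B mA mB.
have mYB : measurable (Y @^-1` B) by exact: measurable_preimage.
have finB : exponential l0 B \is a fin_num by exact: fin_num_measure.
have kE : exponential l0 B = (fine (exponential l0 B))%:E by rewrite fineK.
rewrite (setIC (_ @^-1` A)) setIA [RHS]muleC kE.
apply: scaled_rectangle_unique => //.
- exact: measurableI.
- by rewrite fine_ge0.
- move=> U K mU mK; rewrite -kE lawE2// [RHS]muleC -lawE//.
  by rewrite -setIA [X in _ `&` X]setIC.
Qed.

Lemma integral_service_product (f g : R -> R) :
  measurable_fun setT f -> measurable_fun setT g ->
  (forall x, 0 <= f x)%R -> (forall x, 0 <= g x)%R ->
  \int[Pr]_(w in E) (f (W w) * g (X w))%:E =
  c%:E * \int[Pr]_(w in F) (f (W w))%:E * \int[nu]_(x in `[0%R, +oo[) (g x)%:E.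
Proof.
move=> mf mg f0 g0.
have mfg : measurable_fun setT (fun z : R * R => (f z.1 * g z.2)%:E).
  by apply/measurable_EFinP; apply: measurable_funM; apply: measurableT_comp.
have mfE : measurable_fun setT (EFin \o f) by exact/measurable_EFinP.
have mgE : measurable_fun setT (EFin \o g) by exact/measurable_EFinP.
rewrite (@ge0_integral_indep _ _ _ _ _ _ R Pr E W X nu mE mW mX _ _ mfg).
- transitivity (\int[Pr]_(w in E) ((f (W w))%:E * \int[nu]_x (g x)%:E)).
    apply: eq_integral => w _ /=; rewrite -ge0_integralZl//.
    + by move=> x _; rewrite lee_fin.
    + by rewrite lee_fin.
  rewrite ge0_integralZr//=; last 3 first.
  + apply/measurable_EFinP/measurable_funTS; exact: measurableT_comp.
  + by move=> w _; rewrite lee_fin.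
  + by apply: integral_ge0 => x _; rewrite lee_fin.
  congr (_ * _); last first.
    by apply: integral_nonneg_support => // x; rewrite lee_fin.
  have fE0 x : 0 <= (EFin \o f) x by rewrite lee_fin.
  rewrite -(ge0_integral_law_on Pr mE mW mfE fE0).
  rewrite -(ge0_integral_law_on Pr mF mW mfE fE0).
  rewrite -(@ge0_integral_mscale _ _ _ _ _ _ (NngNum c0))//.
  by apply: eq_measure_integral => A mA _; exact: lawE1.
- by move=> A B mA mB; rewrite lawE2// lawE1.
- by move=> z; rewrite lee_fin mulr_ge0.
Qed.

Let mWX : measurable_fun setT (fun w => W w + X w)%R.
Proof. exact: measurable_funD. Qed.

Let WX0 w : (0 <= W w + X w)%R.
Proof. exact: addr_ge0. Qed.

Lemma integral_service_exp :
  \int[Pr]_(w in E) (expR (- l * (W w + X w)))%:E =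
  c%:E * \int[Pr]_(w in F) (expR (- l * W w))%:E *
    \int[nu]_(x in `[0%R, +oo[) (expR (- l * x))%:E.
Proof.
have mexp : measurable_fun setT (fun x : R => expR (- l * x)).
  by apply: measurableT_comp => //; exact: measurable_funM.
have exp0 (x : R) : (0 <= expR (- l * x))%R by exact: expR_ge0.
rewrite -(integral_service_product mexp mexp exp0 exp0).
by apply: eq_integral => w _; rewrite mulrDr expRD.
Qed.

Lemma integral_service_power r :
  \int[Pr]_(w in E) ((W w + X w) ^+ r)%:E =
  c%:E * \sum_(k < r.+1) ('C(r, k)%:R%:E * (\int[Pr]_(w in F) (W w ^+ k)%:E *
    \int[nu]_(x in `[0%R, +oo[) (x ^+ (r - k))%:E)).
Proof.
(* Absolute values make the integrands nonnegative on all of [R], as [integral_service_product]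
   demands; they change nothing along [W] and [X], nor on the half-line where [nu] is integrated. *)
have mnX k : measurable_fun setT (fun x : R => `|x| ^+ k)%R.
  by apply: measurable_funX; exact: normr_measurable.
have product k : \int[Pr]_(w in E) (`|W w| ^+ k * `|X w| ^+ (r - k))%:E =
    c%:E * (\int[Pr]_(w in F) (W w ^+ k)%:E *
    \int[nu]_(x in `[0%R, +oo[) (x ^+ (r - k))%:E).
  have nX0 s (x : R) : (0 <= `|x| ^+ s)%R by rewrite exprn_ge0.
  apply: (etrans (integral_service_product (mnX k) (mnX (r - k)%N)
    (nX0 k) (nX0 (r - k)%N))).
  rewrite -muleA; congr (_ * (_ * _)).
    by apply: eq_integral => w _; rewrite ger0_norm.
  by apply: eq_integral => x; rewrite inE/= in_itv/= andbT => x0; rewrite ger0_norm.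
rewrite ge0_sume_distrr; last first.
  move=> k _; rewrite mule_ge0// mule_ge0//.
    by apply: integral_ge0 => w _; rewrite lee_fin exprn_ge0.
  by apply: integral_ge0 => x; rewrite /= in_itv/= andbT => x0; rewrite lee_fin exprn_ge0.
transitivity (\int[Pr]_(w in E) \sum_(k < r.+1)
    ('C(r, k)%:R%:E * (`|W w| ^+ k * `|X w| ^+ (r - k))%:E)).
  apply: eq_integral => w _; rewrite addrC exprDn -sumEFin; apply: eq_bigr => k _.
  by rewrite -EFinM !ger0_norm// -mulr_natl (mulrC (X w ^+ _)%R).
have mprod k : measurable_fun E (fun w => (`|W w| ^+ k * `|X w| ^+ (r - k))%:E).
  apply/measurable_EFinP; apply: measurable_funTS; apply: measurable_funM.
    by apply: (measurableT_comp (mnX k)).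
  by apply: (measurableT_comp (mnX _)).
rewrite ge0_integral_sum//; last first.
  by move=> k; apply: emeasurable_funM.
apply: eq_bigr => k _; rewrite ge0_integralZl//.
by rewrite product muleCA.
Qed.

Lemma integral_overflow r :
  \int[Pr]_(w in E) (Num.max (W w + X w - Y w) 0 ^+ r.+1)%:E =
  l%:E * \int[Pr]_(w in E) (truncated_moment l r.+1 (W w + X w))%:E.
Proof.
rewrite (@ge0_integral_service (fun z => (Num.max (z.1 - z.2) 0 ^+ r.+1)%:E));
  last 2 first.
- apply/measurable_EFinP/measurable_funX; apply: measurable_maxr => //.
  exact: measurable_funB.
- by move=> z; rewrite lee_fin exprn_ge0// le_max lexx orbT.
rewrite -ge0_integralZl//; last 3 first.
- apply/measurable_EFinP/measurable_funTS.
  exact: (measurableT_comp (measurable_truncated_moment l r.+1)).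
- by move=> w _; rewrite lee_fin truncated_moment_ge0.
- by rewrite lee_fin ltW.
by apply: eq_integral => w _; rewrite integral_exponential_maxBl// EFinM.
Qed.

(** The integrated form of the recurrence defining [truncated_moment], written as a sum because the
    terms may be infinite. *)
Lemma integral_overflow_rec r :
  l%:E * \int[Pr]_(w in E) (truncated_moment l r.+1 (W w + X w))%:E +
  r.+1%:R%:E * \int[Pr]_(w in E) (truncated_moment l r (W w + X w))%:E =
  \int[Pr]_(w in E) ((W w + X w) ^+ r.+1)%:E.
Proof.
have mtm s : measurable_fun E (fun w => (truncated_moment l s (W w + X w))%:E).
  apply/measurable_EFinP/measurable_funTS.
  exact: (measurableT_comp (measurable_truncated_moment l s)).
have tm0 s w : E w -> 0 <= (truncated_moment l s (W w + X w))%:E.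
  by move=> _; rewrite lee_fin truncated_moment_ge0.
have l0' : 0 <= l%:E by rewrite lee_fin ltW.
rewrite -!ge0_integralZl//; do ?[exact: mtm | exact: tm0].
rewrite -ge0_integralD//; last 4 first.
- by move=> w Ew; apply: mule_ge0 => //; exact: tm0.
- by apply: emeasurable_funM => //; exact: mtm.
- by move=> w Ew; apply: mule_ge0 => //; exact: tm0.
- by apply: emeasurable_funM => //; exact: mtm.
apply: eq_integral => w _; rewrite -!EFinM -EFinD; congr EFin => /=.
by field; rewrite gt_eqF.
Qed.

Lemma integral_overflow_rec0 :
  l%:E * \int[Pr]_(w in E) (truncated_moment l 0 (W w + X w))%:E +
  \int[Pr]_(w in E) (expR (- l * (W w + X w)))%:E = c%:E * Pr F.
Proof.
have mtm : measurable_fun E (fun w => (truncated_moment l 0 (W w + X w))%:E).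
  apply/measurable_EFinP/measurable_funTS.
  exact: (measurableT_comp (measurable_truncated_moment l 0)).
have tm0 w : E w -> 0 <= (truncated_moment l 0 (W w + X w))%:E.
  by move=> _; rewrite lee_fin truncated_moment_ge0.
have l0' : 0 <= l%:E by rewrite lee_fin ltW.
have ltm0 w : E w -> 0 <= l%:E * (truncated_moment l 0 (W w + X w))%:E.
  by move=> Ew; apply: mule_ge0 => //; exact: tm0.
have mltm : measurable_fun E
    (fun w => l%:E * (truncated_moment l 0 (W w + X w))%:E).
  exact: emeasurable_funM.
have e0 w : E w -> 0 <= (expR (- l * (W w + X w)))%:E.
  by move=> _; rewrite lee_fin expR_ge0.
have me : measurable_fun E (fun w => (expR (- l * (W w + X w)))%:E).
  apply/measurable_EFinP/measurable_funTS; apply: measurableT_comp => //.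
  exact: measurable_funM.
rewrite -ge0_integralZl// -ge0_integralD//.
transitivity (\int[Pr]_(w in E) (cst 1 w)).
  apply: eq_integral => w _; rewrite -EFinM -EFinD; congr EFin => /=.
  by field; rewrite gt_eqF.
rewrite integral_cst// mul1e.
by have := lawE1 measurableT; rewrite preimage_setT !setIT.
Qed.

Lemma integral_underflow r :
  \int[Pr]_(w in E) (Num.max (Y w - (W w + X w)) 0 ^+ r.+1)%:E =
  ((r.+1)`!%:R / l ^+ r.+1)%:E * (c%:E * \int[Pr]_(w in F) (expR (- l * W w))%:E *
    \int[nu]_(x in `[0%R, +oo[) (expR (- l * x))%:E).
Proof.
rewrite (@ge0_integral_service (fun z => (Num.max (z.2 - z.1) 0 ^+ r.+1)%:E));
  last 2 first.
- apply/measurable_EFinP/measurable_funX; apply: measurable_maxr => //.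
  exact: measurable_funB.
- by move=> z; rewrite lee_fin exprn_ge0// le_max lexx orbT.
have me : measurable_fun E (fun w => (expR (- l * (W w + X w)))%:E).
  apply/measurable_EFinP/measurable_funTS; apply: measurableT_comp => //.
  exact: measurable_funM.
have lr0 : 0 <= ((r.+1)`!%:R / l ^+ r.+1)%:E.
  by rewrite lee_fin divr_ge0// exprn_ge0// ltW.
rewrite -integral_service_exp -ge0_integralZl//.
by apply: eq_integral => w _; rewrite integral_exponential_maxBr// EFinM.
Qed.

End one_step.

(** * Conditional laws in Model II *)

Section conditional_law.
Context d (T : measurableType d) (R : realType) (Pr : probability T R).
Variables (F G : set T) (W X Y : T -> R) (nu ex : probability R R) (l q : R).
Hypothesis ex_ray : forall x : R,
  ex `]-oo, x]%classic = (if 0 <= x then 1 - expR (- l * x) else 0)%:E.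
Hypotheses (q0 : 0 <= q) (nu0 : nu `[0%R, +oo[%classic = 1%E).
Hypotheses (mF : measurable F) (mG : measurable G).
Hypotheses (mW : measurable_fun setT W) (mX : measurable_fun setT X).
Hypotheses (mY : measurable_fun setT Y).
Hypotheses (X0 : forall w, 0 <= X w) (Y0 : forall w, 0 <= Y w).
Hypothesis law : forall x y, (0 < Pr F)%E -> 0 <= x -> 0 <= y ->
  cprob Pr ([set w | Y w <= x /\ X w <= y] `&` G) F =
  q * fine (nu `]-oo, y]%classic) * (1 - expR (- l * x)).
Local Open Scope ereal_scope.

Lemma law_negative_ray (y : R) : (y < 0)%R -> nu `]-oo, y]%classic = 0.
Proof.
move=> y0; apply/eqP; rewrite eq_le measure_ge0 andbT.
have <- : nu (~` `[0%R, +oo[%classic) = 0.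
  by rewrite probability_setC// nu0 subee.
rewrite le_measure// ?inE//; first exact: measurableC.
move=> x /=; rewrite !in_itv/= andbT => xy; apply/negP; rewrite -ltNge.
exact: le_lt_trans xy y0.
Qed.

(** [law] gives the product form on quadrants with nonnegative corner; on the others both sides
    vanish, since [X] and [Y] are nonnegative and [nu] and [ex] charge no negative ray. Uniqueness
    on rays then replaces one ray by [L] and afterwards the other by [K]. *)
Lemma joint_law K L : 0 < Pr F -> measurable K -> measurable L ->
  Pr (F `&` (G `&` (X @^-1` K `&` Y @^-1` L))) =
  (fine (Pr F) * q)%:E * nu K * ex L.
Proof.
move=> F0 mK mL.
have mXp B : measurable B -> measurable (X @^-1` B) by exact: measurable_preimage.
have mYp B : measurable B -> measurable (Y @^-1` B) by exact: measurable_preimage.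
have fF0 : (0 <= fine (Pr F))%R by rewrite fine_ge0.
have finnu B : measurable B -> nu B = (fine (nu B))%:E.
  by move=> mB; rewrite fineK// fin_num_measure.
have finE B : measurable B -> ex B = (fine (ex B))%:E.
  by move=> mB; rewrite fineK// fin_num_measure.
have rays (x y : R) :
    Pr (F `&` (G `&` (X @^-1` `]-oo, y]%classic `&` Y @^-1` `]-oo, x]%classic))) =
    (fine (Pr F) * q)%:E * nu `]-oo, y]%classic * ex `]-oo, x]%classic.
  rewrite ex_ray.
  have [x0|x0] := leP 0%R x; last first.
    rewrite mule0 (_ : _ `&` _ = set0) ?measure0//.
    apply/seteqP; split => // w [_ [_ [_]]]; rewrite /= in_itv/= => Yx.
    by have := le_lt_trans (Y0 w) (le_lt_trans Yx x0); rewrite ltxx.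
  have [y0|y0] := leP 0%R y; last first.
    rewrite law_negative_ray// mule0 mul0e (_ : _ `&` _ = set0) ?measure0//.
    apply/seteqP; split => // w [_ [_ []]]; rewrite /= in_itv/= => Xy.
    by have := le_lt_trans (X0 w) (le_lt_trans Xy y0); rewrite ltxx.
  have := law F0 x0 y0; rewrite /cprob.
  rewrite (_ : _ `&` F = F `&` (G `&` (X @^-1` `]-oo, y]%classic `&`
     Y @^-1` `]-oo, x]%classic))); last first.
    by apply/seteqP; split => w /=; rewrite !in_itv/=; tauto.
  have finP : Pr (F `&` (G `&` (X @^-1` `]-oo, y]%classic `&`
     Y @^-1` `]-oo, x]%classic))) \is a fin_num.
    apply: fin_num_measure; do 3 (apply: measurableI => //).
      exact: mXp.
    exact: mYp.
  have fF : fine (Pr F) != 0%R by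
    rewrite gt_eqF// fine_gt0// F0 -ge0_fin_numE// fin_num_measure.
  rewrite -(fineK finP) (finnu `]-oo, y]%classic)// -!EFinM => h; congr EFin.
  by rewrite -!mulrA [RHS]mulrC mulrA -h divfK.
have half (y : R) : Pr (F `&` (G `&` (X @^-1` `]-oo, y]%classic `&` Y @^-1` L))) =
    (fine (Pr F) * q)%:E * nu `]-oo, y]%classic * ex L.
  rewrite (finnu `]-oo, y]%classic)// -EFinM.
  rewrite (_ : _ `&` _ = (F `&` (G `&` X @^-1` `]-oo, y]%classic)) `&` Y @^-1` L);
    last by rewrite !setIA.
  apply: scaled_ray_unique => //.
  - by do 2 apply: measurableI => //; exact: mXp.
  - by rewrite !mulr_ge0// fine_ge0.
  - by move=> x; rewrite EFinM -finnu// -rays !setIA.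
rewrite (finE L)// muleAC -EFinM.
rewrite (_ : _ `&` _ = (F `&` (G `&` Y @^-1` L)) `&` X @^-1` K); last first.
  by apply/seteqP; split => w /=; tauto.
apply: scaled_ray_unique => //.
- by do 2 apply: measurableI => //; exact: mYp.
- by rewrite !mulr_ge0// fine_ge0.
- move=> y; rewrite EFinM -finE// muleAC -half; congr (Pr _).
  by apply/seteqP; split => w /=; tauto.
Qed.

Lemma joint_law_past (G1 G2 : set (set T)) U K L :
  cond_indep Pr F G1 G2 ->
  measurable U -> measurable K -> measurable L ->
  G1 (G `&` (X @^-1` K `&` Y @^-1` L)) -> G2 (W @^-1` U) ->
  Pr (F `&` (G `&` (X @^-1` K `&` Y @^-1` L) `&` W @^-1` U)) =
  q%:E * Pr (F `&` W @^-1` U) * nu K * ex L.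
Proof.
move=> indepF mU mK mL G1KL G2U.
have mWp : measurable (W @^-1` U) by exact: measurable_preimage.
have mXYp : measurable (G `&` (X @^-1` K `&` Y @^-1` L)).
  by apply: measurableI => //; apply: measurableI; exact: measurable_preimage.
(* On a null [F] the conditional hypotheses say nothing, but both sides are 0. *)
have [F0|] := eqVneq (Pr F) 0.
  have sub0 B : measurable B -> Pr (F `&` B) = 0.
    move=> mB; apply/eqP; rewrite eq_le measure_ge0 andbT -F0.
    by rewrite le_measure// ?inE//; exact: measurableI.
  by rewrite !sub0// ?mule0 ?mul0e//; exact: measurableI.
rewrite neq_lt ltNge measure_ge0/= => F0.
have := indepF F0 _ _ G1KL G2U; rewrite /cprob.
have finPr B : measurable B -> Pr B = (fine (Pr B))%:E.
  by move=> mB; rewrite fineK// fin_num_measure.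
have fF : fine (Pr F) != 0%R by
    rewrite gt_eqF// fine_gt0// F0 -ge0_fin_numE// fin_num_measure.
rewrite ![_ `&` F]setIC joint_law// => h.
rewrite finPr; last by do 2 apply: measurableI => //.
move: h => /(congr1 ( *%R^~ (fine (Pr F)))); rewrite divfK// => ->.
rewrite -(fineK (fin_num_measure nu K mK)).
rewrite -(fineK (fin_num_measure ex L mL)).
rewrite (finPr (F `&` W @^-1` U)); last exact: measurableI.
move: (fine (nu K)) (fine (ex L)) => a b.
by rewrite -!EFinM; congr EFin; rewrite /fine; field.
Qed.

End conditional_law.

Section sigma_gen.
Context d (T : measurableType d) (R : realType).
Implicit Types (F : set (T -> R)) (X : T -> R).

Lemma sigma_gen_preimage F X U : F X -> measurable U ->
  sigma_gen F (X @^-1` U).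
Proof.
move=> FX mU; apply: sub_sigma_algebra; exists X => //; exists U => //.
by rewrite setTI.
Qed.

Lemma sigma_genI F A B : sigma_gen F A -> sigma_gen F B -> sigma_gen F (A `&` B).
Proof.
move=> FA FB.
exact: (@measurableI _ (g_sigma_algebraType
  (\bigcup_(X in F) preimage_set_system setT X measurable))).
Qed.

End sigma_gen.

(** * One-step relations of the model *)

Section model.
Context (R : realType) (N : nat) d (T : measurableType d).
Variable Pr : probability T R.
Variables (P : 'M[R]_N) (p : R) (lam mu : 'rV[R]_N).
Variables (B C : 'I_N -> probability R R).
Variables (Z : nat -> T -> 'I_N) (V W S A Cn D : nat -> {RV Pr >-> R}).
Hypotheses (hP : stochastic P) (hp : 0 < p < 1).
Hypothesis hmodel : model_II Pr P p lam mu B C Z V W S A Cn D.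

Definition state n i : set T := Z n @^-1` [set i].

Definition transition n v i j : set T :=
  V n @^-1` [set v] `&` (state n i `&` state n.+1 j).

Lemma measurable_state n i : measurable (state n i).
Proof. exact: (mII_Z_meas hmodel). Qed.

Lemma measurable_transition n v i j : measurable (transition n v i j).
Proof.
apply: measurableI; first exact: measurable_preimage.
by apply: measurableI; exact: measurable_state.
Qed.

(** The sigma-algebras of the model are generated by real functions and see the state through
    [realZ]; this places the events [state n i] in them. *)
Lemma state_realZ n i : state n i = realZ (R:=R) Z n @^-1` [set (i : nat)%:R].
Proof.
apply/seteqP; split => w /=; first by rewrite /state /realZ => ->.
by rewrite /realZ => /eqP; rewrite eqr_nat => /eqP /val_inj.
Qed.

Let past_W n U : measurable U -> past Z V W S A Cn D n (W n @^-1` U).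
Proof.
by move=> mU; apply: sigma_gen_preimage => //; left; exists n => //=; left.
Qed.

(* Applied to ([X], [Y]) = ([S n], [A n.+1]) and ([Cn n], [D n.+1]). *)
Lemma transition_law n v i j (X Y : {RV Pr >-> R}) (nu : probability R R)
    (l q : R) (l0 : 0 < l) U K L :
  nu `[0%R, +oo[%classic = 1%E ->
  (forall w, 0 <= X w) -> (forall w, 0 <= Y w) ->
  environment Z S A Cn D X -> environment Z S A Cn D Y ->
  Pr (V n @^-1` [set v]) = q%:E ->
  cond_indep Pr (state n i) (sigma_gen [set (Y : T -> R); (X : T -> R); realZ Z n.+1])
    (past Z V W S A Cn D n) ->
  (forall x y, (0 < Pr (state n i))%E -> 0 <= x -> 0 <= y ->
    cprob Pr [set w | [/\ Y w <= x, X w <= y & Z n.+1 w = j]] (state n i) =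
    P i j * fine (nu `]-oo, y]%classic) * (1 - expR (- l * x))) ->
  measurable U -> measurable K -> measurable L ->
  (Pr (transition n v i j `&` (W n @^-1` U `&` X @^-1` K `&` Y @^-1` L)) =
  (q * P i j)%:E * Pr (state n i `&` W n @^-1` U) * nu K * exponential l0 L)%E.
Proof.
move=> nu0 X0 Y0 envX envY Vq indepF law mU mK mL.
pose A1 := state n.+1 j `&` (X @^-1` K `&` Y @^-1` L).
have envZ k : environment Z S A Cn D (realZ (R:=R) Z k).
  by exists k => //; left; left; left; left.
have step : Pr (state n i `&` (A1 `&` W n @^-1` U)) =
    ((P i j)%:E * Pr (state n i `&` W n @^-1` U) * nu K * exponential l0 L)%E.
  apply: (@joint_law_past _ _ _ Pr (state n i) (state n.+1 j) (W n) X Y nu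
    (exponential l0) l (P i j) _ _ _ _ _ _ _ _ _ _ _ _ _ _ _ _ indepF) => //.
  - exact: exponential_ray.
  - exact: hP.1.
  - exact: measurable_state.
  - exact: measurable_state.
  - move=> x y F0 x0 y0; rewrite -law//; congr cprob.
    by apply/seteqP; split => w /= [] // [].
  - rewrite state_realZ; apply: sigma_genI; first by apply: sigma_gen_preimage => //; right.
    by apply: sigma_genI; apply: sigma_gen_preimage => //; left; [right|left].
  - exact: past_W.
have sgV : sigma_gen [set (V n : T -> R)] (V n @^-1` [set v]).
  exact: sigma_gen_preimage.
(* Everything in the event besides [V n] is generated by [W n] and the environment, so the condition
   on [V n] splits off as the factor [q]. *)
have sgW : sigma_gen ((W n : T -> R) |` environment Z S A Cn D)
    (state n i `&` (A1 `&` W n @^-1` U)).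
  have sgWU : sigma_gen ((W n : T -> R) |` environment Z S A Cn D) (W n @^-1` U).
    by apply: sigma_gen_preimage => //; left.
  apply: sigma_genI; first by rewrite state_realZ; apply: sigma_gen_preimage => //; right.
  apply: sigma_genI => //; apply: sigma_genI.
    by rewrite state_realZ; apply: sigma_gen_preimage => //; right.
  by apply: sigma_genI; apply: sigma_gen_preimage => //; right.
transitivity (q%:E * Pr (state n i `&` (A1 `&` W n @^-1` U)))%E; last first.
  by rewrite step EFinM !muleA.
rewrite -Vq -(mII_V_indep hmodel sgV sgW); congr (Pr _).
by apply/seteqP; split => w /=; rewrite /transition/= /A1/=; tauto.
Qed.

Lemma transition_law_up n (i j : 'I_N) (l0 : 0 < lam 0 j) U K L :
  measurable U -> measurable K -> measurable L ->
  (Pr (transition n 1%R i j `&` (W n @^-1` U `&` S n @^-1` K `&` A n.+1 @^-1` L)) =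
  (p * P i j)%:E * Pr (state n i `&` W n @^-1` U) * B i K * exponential l0 L)%E.
Proof.
apply: transition_law.
- exact: (mII_B hmodel).
- exact: (mII_S_ge0 hmodel).
- exact: (mII_A_ge0 hmodel).
- by exists n => //; left; left; left; right.
- by exists n => //; left; left; right.
- exact: (mII_V_law1 hmodel).
- exact: (mII_AS_past hmodel).
- exact: (mII_AS_law hmodel).
Qed.

Lemma transition_law_down n (i j : 'I_N) (l0 : 0 < mu 0 j) U K L :
  measurable U -> measurable K -> measurable L ->
  (Pr (transition n (-1)%R i j `&` (W n @^-1` U `&` Cn n @^-1` K `&` D n.+1 @^-1` L)) =
  ((1 - p) * P i j)%:E * Pr (state n i `&` W n @^-1` U) * C i K * exponential l0 L)%E.
Proof.
apply: transition_law.
- exact: (mII_C hmodel).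
- exact: (mII_C_ge0 hmodel).
- exact: (mII_D_ge0 hmodel).
- by exists n => //; left; right.
- by exists n => //; right.
- exact: (mII_V_lawN1 hmodel).
- exact: (mII_DC_past hmodel).
- exact: (mII_DC_law hmodel).
Qed.

Lemma integral_state_split n j (f : T -> \bar R) :
  measurable_fun setT f -> (forall w, (0 <= f w)%E) ->
  (\int[Pr]_(w in state n.+1 j) f w =
   \sum_i (\int[Pr]_(w in transition n 1%R i j) f w +
           \int[Pr]_(w in transition n (-1)%R i j) f w))%E.
Proof.
move=> mf f0.
have mV v : measurable (V n @^-1` [set v]) by exact: measurable_preimage.
have disjV : V n @^-1` [set 1] `&` V n @^-1` [set -1] = set0.
  apply/seteqP; split => // w /= [-> /eqP].
  by rewrite -subr_eq0 opprK (_ : 1 + 1 = 2%:R) ?pnatr_eq0// -natr1.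
(* [V n] takes the values 1 and -1 almost surely only; the exceptional set is null because [p] and
   [1 - p] add up to 1. *)
pose V0 := ~` (V n @^-1` [set 1] `|` V n @^-1` [set -1]).
have mV0 : measurable V0 by apply: measurableC; exact: measurableU.
have PV0 : Pr V0 = 0%E.
  rewrite probability_setC; last exact: measurableU.
  have V1 : Pr (V n @^-1` [set 1]) = p%:E by exact: (mII_V_law1 hmodel).
  have VN1 : Pr (V n @^-1` [set -1]) = (1 - p)%:E by exact: (mII_V_lawN1 hmodel).
  rewrite measureU//; transitivity (1 - (p%:E + (1 - p)%:E))%E.
    by congr (_ - (_ + _))%E; [exact: V1|exact: VN1].
  by rewrite -!EFinD; congr EFin; ring.
have mt v i := measurable_transition n v i j.
rewrite (ge0_negligible_integral mV0 _ _ _ PV0)//; last 2 first.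
- exact: measurable_state.
- exact: measurable_funTS.
have -> : state n.+1 j `\` V0 = \big[setU/set0]_(i <- index_enum 'I_N)
    (transition n 1%R i j `|` transition n (-1)%R i j).
  rewrite -bigcup_seq; apply/seteqP; split => w.
    move=> [jw /contrapT Vw]; exists (Z n w); first exact: mem_index_enum.
    by case: Vw => Vw; [left|right]; split.
  move=> [i _ [[Vw [_ jw]]|[Vw [_ jw]]]]; split => //; apply.
    by left.
  by right.
rewrite ge0_integral_bigsetU//.
- apply: eq_bigr => i _; rewrite ge0_integral_setU//.
    exact: measurable_funTS.
  rewrite disj_set2E; apply/eqP; rewrite /transition setIACA disjV.
  by rewrite set0I.
- by move=> i; exact: measurableU.
- exact: index_enum_uniq.
- apply/trivIsetP => i k _ _ /eqP ik; apply/seteqP; split => // w.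
  by move=> [[[_ [iw _]]|[_ [iw _]]] [[_ [kw _]]|[_ [kw _]]]];
    apply: ik; rewrite -iw -kw.
- exact: measurable_funTS.
Qed.

(** The overflow part stays a truncated moment: expressing it through moments of [W n] takes a
    subtraction, which has to wait until finiteness is known. *)
Lemma moment_step n r j (l0 : 0 < lam 0 j) (mu0 : 0 < mu 0 j) :
  (\int[Pr]_(w in state n.+1 j) (W n.+1 w ^+ r.+1)%:E =
   \sum_i ((lam 0 j)%:E * \int[Pr]_(w in transition n 1%R i j)
              (truncated_moment (lam 0 j) r.+1 (W n w + S n w))%:E +
     ((r.+1)`!%:R / mu 0 j ^+ r.+1)%:E *
       (((1 - p) * P i j)%:E *
        \int[Pr]_(w in state n i) (expR (- mu 0 j * W n w))%:E *
        \int[C i]_(x in `[0%R, +oo[) (expR (- mu 0 j * x))%:E)))%E.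
Proof.
have W0 := mII_W_ge0 hmodel.
have mW : measurable_fun setT (W n) by [].
have mS : measurable_fun setT (S n) by [].
have mA : measurable_fun setT (A n.+1) by [].
have mC : measurable_fun setT (Cn n) by [].
have mD : measurable_fun setT (D n.+1) by [].
rewrite integral_state_split; last 2 first.
- by apply/measurable_EFinP; exact: measurable_funX.
- by move=> w; rewrite lee_fin exprn_ge0// W0.
apply: eq_bigr => i _; congr (_ + _)%E.
- have mt := measurable_transition n 1 i j.
  rewrite -(integral_overflow mt mW mS mA (W0 n) (mII_S_ge0 hmodel n)
    (fun U K L => @transition_law_up n i j l0 U K L)).
  apply: eq_integral => w; rewrite inE => -[Vw _]; rewrite (mII_W_rec hmodel) Vw.
  by rewrite mul1r /Y eqxx addrA.
- have mt := measurable_transition n (-1) i j.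
  have c0 : 0 <= (1 - p) * P i j.
    by rewrite mulr_ge0 ?(hP.1)// subr_ge0 ltW//; case/andP: hp.
  rewrite -(integral_underflow mt (measurable_state n i) mW mC mD (W0 n)
    (mII_C_ge0 hmodel n) c0 (mII_C hmodel i)
    (fun U K L => @transition_law_down n i j mu0 U K L)).
  apply: eq_integral => w; rewrite inE => -[Vw _]; rewrite (mII_W_rec hmodel) Vw.
  rewrite mulN1r /Y ifF; last first.
    apply/negbTE/eqP => /eqP; rewrite eq_sym -subr_eq0 opprK.
    by rewrite (_ : 1 + 1 = 2%:R) ?pnatr_eq0// -natr1.
  by congr ((Num.max _ _ ^+ _)%:E); ring.
Qed.

Lemma overflow_step n r i j (l0 : 0 < lam 0 j) :
  ((lam 0 j)%:E * \int[Pr]_(w in transition n 1%R i j)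
      (truncated_moment (lam 0 j) r.+1 (W n w + S n w))%:E +
   r.+1%:R%:E * \int[Pr]_(w in transition n 1%R i j)
      (truncated_moment (lam 0 j) r (W n w + S n w))%:E =
   (p * P i j)%:E * \sum_(k < r.+2) ('C(r.+1, k)%:R%:E *
     (\int[Pr]_(w in state n i) (W n w ^+ k)%:E *
      \int[B i]_(x in `[0%R, +oo[) (x ^+ (r.+1 - k))%:E)))%E.
Proof.
have mt := measurable_transition n 1 i j.
have ms := measurable_state n i.
have mW : measurable_fun setT (W n) by [].
have mS : measurable_fun setT (S n) by [].
have S0 := mII_S_ge0 hmodel n.
have W0 := mII_W_ge0 hmodel n.
have c0 : 0 <= p * P i j by rewrite mulr_ge0 ?(hP.1)// ltW//; case/andP: hp.
have B0 := mII_B hmodel i.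
have lawU U K L := @transition_law_up n i j l0 U K L.
rewrite (integral_overflow_rec Pr l0 mt mW mS W0 S0).
exact: (integral_service_power mt ms mW mS W0 S0 c0 B0 lawU).
Qed.

Lemma overflow_step0 n i j (l0 : 0 < lam 0 j) :
  ((lam 0 j)%:E * \int[Pr]_(w in transition n 1%R i j)
      (truncated_moment (lam 0 j) 0 (W n w + S n w))%:E +
   (p * P i j)%:E * \int[Pr]_(w in state n i) (expR (- lam 0 j * W n w))%:E *
     \int[B i]_(x in `[0%R, +oo[) (expR (- lam 0 j * x))%:E =
   (p * P i j)%:E * Pr (state n i))%E.
Proof.
have mt := measurable_transition n 1 i j.
have ms := measurable_state n i.
have mW : measurable_fun setT (W n) by [].
have mS : measurable_fun setT (S n) by [].
have S0 := mII_S_ge0 hmodel n.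
have W0 := mII_W_ge0 hmodel n.
have c0 : 0 <= p * P i j by rewrite mulr_ge0 ?(hP.1)// ltW//; case/andP: hp.
have B0 := mII_B hmodel i.
have lawU U K L := @transition_law_up n i j l0 U K L.
rewrite -(integral_service_exp mt ms mW mS c0 B0 lawU).
exact: (integral_overflow_rec0 mt mW mS W0 S0 lawU).
Qed.

(** With all three sets equal to [setT] the transition laws give the mass of each [transition], and
    the weights [p] and [1 - p] recombine. In the limit this makes [m 0] invariant under [P]. *)
Lemma state_step n j :
  (Pr (state n.+1 j) = \sum_i (P i j)%:E * Pr (state n i))%E.
Proof.
have := @integral_state_split n j (cst 1%E) (measurable_cst _) (fun=> lee01).
rewrite integral_cst ?mul1e; last exact: measurable_state.
move=> ->; apply: eq_bigr => i _.
rewrite !integral_cst ?mul1e//; [|exact: measurable_transition..].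
have l0 := mII_lam hmodel j; have mu0 := mII_mu hmodel j.
transitivity ((p * P i j)%:E * Pr (state n i) +
    ((1 - p) * P i j)%:E * Pr (state n i))%E.
  congr (_ + _)%E.
    have := transition_law_up n i l0 measurableT measurableT measurableT.
    by rewrite !preimage_setT !setIT !probability_setT !mule1; apply.
  have := transition_law_down n i mu0 measurableT measurableT measurableT.
  by rewrite !preimage_setT !setIT !probability_setT !mule1; apply.
rewrite -ge0_muleDl; last 2 first.
- by rewrite lee_fin mulr_ge0 ?(hP.1)// ltW//; case/andP: hp.
- by rewrite lee_fin mulr_ge0 ?(hP.1)// subr_ge0 ltW//; case/andP: hp.
by rewrite -EFinD -mulrDl addrC subrK mul1r.
Qed.

End model.

(** * Passage to the limit *)

Section transforms.
Context (R : realType) (N : nat) d (T : measurableType d).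
Variable Pr : probability T R.
Variables (Z : nat -> T -> 'I_N) (W : nat -> T -> R).

Lemma momentE n r i :
  moment Pr Z W n r i = (\int[Pr]_(w in state Z n i) (W n w ^+ r)%:E)%E.
Proof.
rewrite /moment expectation.unlock [RHS]integral_mkcond.
apply: eq_integral => w _; rewrite patchE indicE.
by case: ifPn => _; rewrite /= ?mulr1 ?mulr0.
Qed.

Lemma Re_transform n i (s : R) : complex.Re (transform Pr Z W n i (s%:C)%C) =
  fine (\int[Pr]_(w in state Z n i) (expR (- s * W n w))%:E)%E.
Proof.
rewrite /transform /cexpectation /= /Rintegral; congr fine.
rewrite [RHS]integral_mkcond; apply: eq_integral => w _.
rewrite patchE indicE /cexp /=.
by case: ifPn => _; congr EFin;
  rewrite /= !(oppr0, mulr0, mul0r, addr0, subr0, cos0, sin0, mulr1).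
Qed.

End transforms.

Section fin_num.
Context (R : realType).
Local Open Scope ereal_scope.

(** Carries finiteness from the moments to the two overflow integrals on the left of
    [overflow_step]. *)
Lemma fin_num_addP (x y : \bar R) (a b z : R) : (0 < a)%R -> (0 < b)%R ->
  0 <= x -> 0 <= y -> a%:E * x + b%:E * y = z%:E ->
  [/\ x \is a fin_num, y \is a fin_num & (a * fine x + b * fine y = z)%R].
Proof.
move=> a0 b0; case: x => [x| |]//; case: y => [y| |]// _ _.
- by rewrite -!EFinM -EFinD => -[].
- by rewrite gt0_muley ?lte_fin.
- by rewrite gt0_muley ?lte_fin.
- by rewrite !gt0_muley ?lte_fin.
Qed.

Lemma integral_expRN_fin d (T : measurableType d) (nu : probability T R)
    (D : set T) (s : R) (X : T -> R) : measurable D -> measurable_fun setT X ->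
  (0 <= s)%R -> (forall w, D w -> 0 <= X w)%R ->
  \int[nu]_(w in D) (expR (- s * X w))%:E \is a fin_num.
Proof.
move=> mD mX s0 X0; rewrite ge0_fin_numE; last first.
  by apply: integral_ge0 => w _; rewrite lee_fin expR_ge0.
apply: (@le_lt_trans _ _ (\int[nu]_(w in D) cst 1 w)).
  apply: ge0_le_integral => //.
  - apply/measurable_EFinP/measurable_funTS; apply: measurableT_comp => //.
    exact: measurable_funM.
  - by move=> w Dw; rewrite lee_fin -expR0 ler_expR mulNr oppr_le0 mulr_ge0// X0.
by rewrite integral_cst// mul1e (le_lt_trans (probability_le1 _ _))// ltry.
Qed.

End fin_num.

Lemma cvgr_sum (R : realType) (I : Type) (s : seq I) (u : I -> nat -> R)
    (l : I -> R) : (forall i, u i n @[n --> \oo] --> l i) ->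
  (\sum_(i <- s) u i n) @[n --> \oo] --> \sum_(i <- s) l i.
Proof.
move=> ul; elim: s => [|i s IHs].
  by rewrite big_nil; under eq_fun do rewrite big_nil; exact: cvg_cst.
rewrite big_cons; under eq_fun do rewrite big_cons.
by apply: cvgD => //; exact: ul.
Qed.

Section limits.
Context (R : realType) (N : nat) d (T : measurableType d).
Variable Pr : probability T R.
Variables (P : 'M[R]_N) (pi : 'cV[R]_N) (p : R) (lam mu : 'rV[R]_N).
Variables (B C : 'I_N -> probability R R).
Variables (Z : nat -> T -> 'I_N) (V W S A Cn D : nat -> {RV Pr >-> R}).
Variables (Phi : 'I_N -> R[i] -> R[i]) (m gam : nat -> 'rV[R]_N).
Hypotheses (hP : stochastic P) (hp : 0 < p < 1).
Hypothesis hmodel : model_II Pr P p lam mu B C Z V W S A Cn D.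
Hypothesis hPhi : forall i s, 0 <= complex.Re s ->
  ccvg (fun n => transform Pr Z W n i s) (Phi i s).
Hypothesis hm : forall r i, moment Pr Z W n r i @[n --> \oo] --> (m r 0 i)%:E.
Hypothesis hgam : forall r i,
  (\int[B i]_(x in `[0%R, +oo[) (x ^+ r)%:E)%E = (gam r 0 i)%:E.

Let momE n r i :
  moment Pr Z W n r i = (\int[Pr]_(w in state Z n i) (W n w ^+ r)%:E)%E.
Proof. exact: momentE. Qed.

Let mom n r i := fine (moment Pr Z W n r i).
Let lap n s i := fine (\int[Pr]_(w in state Z n i) (expR (- s * W n w))%:E)%E.
Let ovf n r i j := fine (\int[Pr]_(w in transition Z V n 1%R i j)
  (truncated_moment (lam 0 j) r (W n w + S n w))%:E)%E.

Let cvg_mom r i : mom n r i @[n --> \oo] --> m r 0 i.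
Proof. by have /fine_cvgP[] := hm (r := r) (i := i). Qed.

Let near_mom r i : \forall n \near \oo, moment Pr Z W n r i \is a fin_num.
Proof. by have /fine_cvgP[] := hm (r := r) (i := i). Qed.

Let cvg_lap (s : R) i : 0 <= s -> lap n s i @[n --> \oo] --> complex.Re (Phi i (s%:C)%C).
Proof.
move=> s0; have [] := hPhi i (s := (s%:C)%C) s0.
rewrite /lap => h _; apply: cvg_trans h; apply: near_eq_cvg.
by apply: nearW => n; rewrite Re_transform.
Qed.

Let lap_fin n (s : R) i : 0 <= s ->
  (\int[Pr]_(w in state Z n i) (expR (- s * W n w))%:E)%E = (lap n s i)%:E.
Proof.
move=> s0; rewrite fineK// integral_expRN_fin//.
- exact: (measurable_state hmodel).
- by move=> w _; exact: (mII_W_ge0 hmodel).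
Qed.

Let lst_fin (nu : probability R R) (s : R) : 0 <= s ->
  (\int[nu]_(x in `[0%R, +oo[) (expR (- s * x))%:E)%E = (lst nu s)%:E.
Proof.
move=> s0; rewrite fineK// (@integral_expRN_fin _ _ _ nu _ s id)//.
by move=> x; rewrite /= in_itv/= andbT.
Qed.

(** Early moments may be infinite; finitely many orders and states have a common threshold beyond
    which all are finite. *)
Let near_moms r : \forall n \near \oo,
  forall k i, (k <= r)%N -> moment Pr Z W n k i \is a fin_num.
Proof.
have h k : \forall n \near \oo, forall i, moment Pr Z W n k i \is a fin_num.
  by apply: filter_forall => i; exact: near_mom.
elim: r => [|r IHr].
  by near=> n; move=> k i; rewrite leqn0 => /eqP ->; move: i; near: n; exact: h.
near=> n; move=> k i; rewrite leq_eqVlt => /predU1P[->|].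
  by move: i; near: n; exact: h.
by rewrite ltnS => kr; move: k i kr; near: n; exact: IHr.
Unshelve. all: by end_near. Qed.

Let ovf_ge0 n r i j : (0 <= \int[Pr]_(w in transition Z V n 1%R i j)
  (truncated_moment (lam 0 j) r (W n w + S n w))%:E)%E.
Proof.
apply: integral_ge0 => w _; rewrite lee_fin truncated_moment_ge0//.
  exact: (mII_lam hmodel).
by rewrite addr_ge0// ?(mII_W_ge0 hmodel) ?(mII_S_ge0 hmodel).
Qed.

Let ovf_rec0 n i j : lam 0 j * ovf n 0 i j =
  p * P i j * (mom n 0 i - lap n (lam 0 j) i * lst (B i) (lam 0 j)).
Proof.
have l0 := mII_lam hmodel j; have l0' := ltW l0.
have := overflow_step0 hP hp hmodel n i l0.
rewrite lap_fin// lst_fin//.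
have -> : Pr (state Z n i) = (mom n 0 i)%:E.
  rewrite /mom momE; under eq_integral do rewrite expr0.
  rewrite integral_cst ?mul1e; last exact: (measurable_state hmodel).
  by rewrite fineK// fin_num_measure//; exact: (measurable_state hmodel).
move: (ovf_ge0 n 0 i j); rewrite /ovf.
case: (\int[_]_(w in transition Z V n 1%R i j) _)%E => [x| |]//= _.
  by rewrite -!EFinM -EFinD => -[] h; rewrite mulrBr -h; ring.
by rewrite gt0_muley// lte_fin.
Qed.

Let ovf_rec n r i j :
  (forall k i, (k <= r.+1)%N -> moment Pr Z W n k i \is a fin_num) ->
  (\int[Pr]_(w in transition Z V n 1%R i j)
    (truncated_moment (lam 0 j) r.+1 (W n w + S n w))%:E)%E = (ovf n r.+1 i j)%:E /\
  lam 0 j * ovf n r.+1 i j + r.+1%:R * ovf n r i j =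
  p * P i j * \sum_(k < r.+2) 'C(r.+1, k)%:R * (mom n k i * gam (r.+1 - k)%N 0 i).
Proof.
move=> finm; have l0 := mII_lam hmodel j.
have := overflow_step hP hp hmodel n r i l0.
have -> : (\sum_(k < r.+2) ('C(r.+1, k)%:R%:E *
     (\int[Pr]_(w in state Z n i) (W n w ^+ k)%:E *
      \int[B i]_(x in `[0%R, +oo[) (x ^+ (r.+1 - k))%:E)) =
   (\sum_(k < r.+2) 'C(r.+1, k)%:R * (mom n k i * gam (r.+1 - k)%N 0 i))%:E)%E.
  rewrite -sumEFin; apply: eq_bigr => k _.
  by rewrite hgam -momE -(fineK (finm k i _)) -?EFinM// -ltnS.
rewrite -EFinM => /(fin_num_addP l0 (ltr0Sn _ _) (ovf_ge0 _ _ _ _) (ovf_ge0 _ _ _ _)).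
by move=> [f1 _ h]; split; rewrite /ovf ?fineK.
Qed.

Let mom_step n r j :
  (forall k i, (k <= r.+1)%N -> moment Pr Z W n k i \is a fin_num) ->
  mom n.+1 r.+1 j = \sum_i (lam 0 j * ovf n r.+1 i j +
    (r.+1)`!%:R / mu 0 j ^+ r.+1 *
    ((1 - p) * P i j * lap n (mu 0 j) i * lst (C i) (mu 0 j))).
Proof.
move=> finm; have l0 := mII_lam hmodel j; have mu0 := mII_mu hmodel j.
rewrite /mom momE (moment_step hP hp hmodel n r l0 mu0).
under eq_bigr => i _.
  rewrite (ovf_rec i j finm).1 lap_fin ?ltW// lst_fin ?ltW// -!EFinM -EFinD.
  over.
by rewrite sumEFin.
Qed.

(** The limit of [ovf n r i j], found by solving the limiting relations [ovf_rec0] and [ovf_rec] for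
    their top term. *)
Fixpoint limit_overflow r i j : R :=
  if r is s.+1 then
    (p * P i j * \sum_(k < s.+2) 'C(s.+1, k)%:R * (m k 0 i * gam (s.+1 - k)%N 0 i)
     - s.+1%:R * limit_overflow s i j) / lam 0 j
  else p * P i j * (m 0%N 0 i -
    complex.Re (Phi i ((lam 0 j)%:C)%C) * lst (B i) (lam 0 j)) / lam 0 j.

(** Each relation determines the overflow term of order [r.+1] from moments of [W n] and the term of
    order [r]; order 0 is determined by a state probability and a transform, both convergent. *)
Let cvg_ovf r i j : ovf n r i j @[n --> \oo] --> limit_overflow r i j.
Proof.
have l0 := mII_lam hmodel j; have ln0 : lam 0 j != 0 by rewrite gt_eqF.
elim: r => [|r IHr] /=.
  have -> : (fun n => ovf n 0 i j) = (fun n => p * P i j *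
      (mom n 0 i - lap n (lam 0 j) i * lst (B i) (lam 0 j)) / lam 0 j).
    by apply/funext => n; rewrite -ovf_rec0 mulrAC divff// mul1r.
  apply: cvgMl; apply: cvgMr; apply: cvgB; first exact: cvg_mom.
  by apply: cvgMl; apply: cvg_lap; exact: ltW.
have h : (p * P i j * (\sum_(k < r.+2) 'C(r.+1, k)%:R *
      (mom n k i * gam (r.+1 - k)%N 0 i)) - r.+1%:R * ovf n r i j) / lam 0 j
    @[n --> \oo] --> limit_overflow r.+1 i j.
  apply: cvgMl; apply: cvgB; last exact: cvgMr.
  apply: cvgMr; apply: cvgr_sum => k; apply: cvgMr; apply: cvgMl.
  exact: cvg_mom.
apply: cvg_trans h; apply: near_eq_cvg.
near=> n; have finm : forall k i, (k <= r.+1)%N ->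
    moment Pr Z W n k i \is a fin_num.
  by near: n; exact: near_moms.
by rewrite -(ovf_rec i j finm).2 addrK mulrAC divff// mul1r.
Unshelve. all: by end_near. Qed.

Lemma limit_moment r j : m r.+1 0 j = \sum_i (lam 0 j * limit_overflow r.+1 i j +
    (r.+1)`!%:R / mu 0 j ^+ r.+1 *
    ((1 - p) * P i j * complex.Re (Phi i ((mu 0 j)%:C)%C) * lst (C i) (mu 0 j))).
Proof.
have mu0 := mII_mu hmodel j.
have h : (\sum_i (lam 0 j * ovf n r.+1 i j + (r.+1)`!%:R / mu 0 j ^+ r.+1 *
    ((1 - p) * P i j * lap n (mu 0 j) i * lst (C i) (mu 0 j))))
    @[n --> \oo] --> \sum_i (lam 0 j * limit_overflow r.+1 i j +
    (r.+1)`!%:R / mu 0 j ^+ r.+1 *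
    ((1 - p) * P i j * complex.Re (Phi i ((mu 0 j)%:C)%C) * lst (C i) (mu 0 j))).
  apply: cvgr_sum => i; apply: cvgD; first by apply: cvgMr; exact: cvg_ovf.
  apply: cvgMr; apply: cvgMl; apply: cvgMr; apply: cvg_lap; exact: ltW.
(* The moments at time [n.+1] have the same limit as those at time [n]; this turns the one-step
   relation into a stationary equation. *)
have h' : mom n.+1 r.+1 j @[n --> \oo] --> m r.+1 0 j.
  by rewrite (cvg_shiftS (fun n => mom n r.+1 j)).
apply: (cvg_unique _ h'); first exact: norm_hausdorff.
apply: cvg_trans h; apply: near_eq_cvg.
near=> n; have finm : forall k i, (k <= r.+1)%N ->
    moment Pr Z W n k i \is a fin_num.
  by near: n; exact: near_moms.
by rewrite (mom_step j finm).
Unshelve. all: by end_near. Qed.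

Let mom0 n i : moment Pr Z W n 0 i = Pr (state Z n i).
Proof.
rewrite momE; under eq_integral do rewrite expr0.
by rewrite integral_cst ?mul1e//; exact: (measurable_state hmodel).
Qed.

Let Pr_state n i : Pr (state Z n i) = (mom n 0 i)%:E.
Proof.
by rewrite /mom mom0 fineK// fin_num_measure//; exact: (measurable_state hmodel).
Qed.

Lemma limit_state_step : m 0%N *m P = m 0%N.
Proof.
apply/rowP => j; rewrite mxE.
have h : (\sum_i mom n 0 i * P i j) @[n --> \oo] --> \sum_i m 0%N 0 i * P i j.
  by apply: cvgr_sum => i; apply: cvgMl; exact: cvg_mom.
have h' : mom n.+1 0 j @[n --> \oo] --> m 0%N 0 j.
  by rewrite (cvg_shiftS (fun n => mom n 0 j)).
apply/esym; apply: (cvg_unique _ h'); first exact: norm_hausdorff.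
apply: cvg_trans h; apply: near_eq_cvg; apply: nearW => n.
have := state_step hP hp hmodel n j; rewrite Pr_state => hs.
apply: EFin_inj; rewrite -sumEFin hs; apply: eq_bigr => i _.
by rewrite Pr_state -EFinM mulrC.
Qed.

Lemma limit_state_sum : \sum_i m 0%N 0 i = 1.
Proof.
have h : (\sum_i mom n 0 i) @[n --> \oo] --> \sum_i m 0%N 0 i.
  by apply: cvgr_sum => i; exact: cvg_mom.
apply: (cvg_unique _ h); first exact: norm_hausdorff.
have h1 : (1 : R) @[n --> \oo] --> (1 : R) by exact: cvg_cst.
apply: cvg_trans h1; apply: near_eq_cvg; apply: nearW => n.
apply: EFin_inj; rewrite -sumEFin -(probability_setT Pr).
have -> : setT = \big[setU/set0]_(i <- index_enum 'I_N) state Z n i.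
  rewrite -bigcup_seq; apply/seteqP; split => // w _.
  by exists (Z n w) => //; exact: mem_index_enum.
rewrite -[LHS]mul1e -integral_cst; last first.
  by apply: bigsetU_measurable => i _; exact: (measurable_state hmodel).
rewrite ge0_integral_bigsetU//.
- by apply: eq_bigr => i _; rewrite -Pr_state integral_cst ?mul1e//;
    exact: (measurable_state hmodel).
- by move=> i; exact: (measurable_state hmodel).
- exact: index_enum_uniq.
- apply/trivIsetP => i k _ _ /eqP ik; apply/seteqP; split => // w [iw kw].
  by apply: ik; rewrite -iw -kw.
Qed.

End limits.

(** * Linear algebra *)

Section stationary.
Context (R : realType) (N : nat).
Variable P : 'M[R]_N.
Hypothesis hP : stochastic P.

Lemma sum_mul_stochastic (x : 'rV[R]_N) :
  \sum_j (x *m P) 0 j = \sum_i x 0 i.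
Proof.
under eq_bigr do rewrite mxE.
rewrite exchange_big; apply: eq_bigr => i _.
by rewrite -mulr_sumr hP.2 mulr1.
Qed.

(* The positive part of an invariant vector is again invariant, hence zero or
   positive everywhere. *)
Lemma invariant_sum0_eq0 (x : 'rV[R]_N) : irreducible P ->
  x *m P = x -> \sum_i x 0 i = 0 -> x = 0.
Proof.
move=> irr xP x0; pose y : 'rV[R]_N := \row_i Num.max (x 0 i) 0.
have y0 i : 0 <= y 0 i by rewrite mxE le_max lexx orbT.
have yle j : y 0 j <= (y *m P) 0 j.
  rewrite [leLHS]mxE ge_max; apply/andP; split; last first.
    by rewrite mxE sumr_ge0// => i _; rewrite mulr_ge0// hP.1.
  rewrite -[in leLHS]xP !mxE; apply: ler_sum => i _.
  by rewrite ler_wpM2r ?hP.1// mxE le_max lexx.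
(* The entries of [y *m P - y] are nonnegative, and their sum is 0 because [P] preserves total
   mass. *)
have yP : y *m P = y.
  apply/rowP => j; apply/eqP; rewrite -subr_eq0.
  have : \sum_j ((y *m P) 0 j - y 0 j) == 0 by rewrite sumrB sum_mul_stochastic subrr.
  rewrite psumr_eq0; last by move=> i _; rewrite subr_ge0.
  by move=> /allP/(_ j); rewrite mem_index_enum => /(_ isT).
have yPn n : y *m P ^+ n = y.
  elim: n => [|n IHn]; first by rewrite expr0 mulmx1.
  by rewrite exprS mulmxA yP IHn.
have Pn0 n i j : 0 <= (P ^+ n) i j.
  elim: n i j => [|n IHn] i j; first by rewrite expr0 mxE ler0n.
  by rewrite exprS mxE sumr_ge0// => k _; rewrite mulr_ge0// hP.1.
(* One positive entry of [x] would spread through some power of [P] to every entry of [y]; then all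
   entries of [x] would be positive, against their sum being 0. *)
have xle i : x 0 i <= 0.
  rewrite leNgt; apply/negP => xi0.
  have xpos j : 0 < x 0 j.
    have [n Pij] := irr i j.
    have : 0 < y 0 j.
      rewrite -(yPn n) mxE (bigD1 i)//= ltr_pwDl//.
        by rewrite mulr_gt0// mxE lt_max xi0.
      by rewrite sumr_ge0// => k _; rewrite mulr_ge0.
    by rewrite mxE lt_max ltxx orbF.
  have : 0 < \sum_k x 0 k.
    rewrite (bigD1 i)//= ltr_pwDl// sumr_ge0// => k _; exact: ltW.
  by rewrite x0 ltxx.
apply/rowP => j; rewrite mxE; apply/eqP; rewrite -oppr_eq0.
have : \sum_j (- x 0 j) == 0 by rewrite sumrN x0 oppr0.
rewrite psumr_eq0; last by move=> i _; rewrite oppr_ge0.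
by move=> /allP/(_ j); rewrite mem_index_enum => /(_ isT).
Qed.

(** A row vector in the kernel satisfies $v = p\,vP$; as [P] does not increase the $\ell^1$ norm of
    row vectors, $\|v\|_1 \le p\|v\|_1$, which forces $v = 0$. *)
Lemma unitmx_substochastic (p : R) : 0 < p < 1 -> p *: P - 1%:M \in unitmx.
Proof.
move=> /andP[p0 p1]; rewrite -row_free_unit -kermx_eq0; apply/eqP/row_matrixP => i.
rewrite row0; set v := row i _.
have vP : p *: (v *m P) = v.
  apply/eqP; rewrite -subr_eq0 scalemxAr; apply/eqP.
  by rewrite -[X in _ - X]mulmx1 -mulmxBr -row_mul mulmx_ker row0.
have le : \sum_j `|v 0 j| <= p * \sum_j `|v 0 j|.
  have -> : p * \sum_j `|v 0 j| = \sum_j p * \sum_k `|v 0 k| * P k j.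
    rewrite -mulr_sumr exchange_big; congr (_ * _); apply: eq_bigr => k _.
    by rewrite -mulr_sumr hP.2 mulr1.
  apply: ler_sum => j _; rewrite -[in leLHS]vP !mxE normrM (gtr0_norm p0).
  rewrite ler_wpM2l ?(ltW p0)//; apply: (le_trans (ler_norm_sum _ _ _)).
  by apply: ler_sum => k _; rewrite normrM (ger0_norm (hP.1 _ _)).
have s0 : \sum_j `|v 0 j| == 0.
  rewrite eq_le sumr_ge0// andbT leNgt; apply/negP => s0.
  by move: le; rewrite ler_pMl// leNgt p1.
apply/rowP => j; rewrite [RHS]mxE; apply/eqP; rewrite -normr_eq0.
by move: s0; rewrite psumr_eq0// => /allP/(_ j); rewrite mem_index_enum => /(_ isT).
Qed.

End stationary.

(** * The scalar recursion for one state *)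

Section moment_recursion.
Context (R : realType).
(** For a fixed state $j$: [t k r] stands for $\sum_i m_{k,i}\gamma_{r,i}p_{i,j}$, [H] for the
    limiting truncated moments summed over the previous state, [v] for $v_j^{(1)}$, and [kappa] for
    the limiting probability of a downward step into $j$ that ends above 0. *)
Variables (l mu p kappa v : R) (t : nat -> nat -> R) (m H : nat -> R).
Hypotheses (l0 : l != 0) (mu0 : mu != 0).
Hypothesis H0 : l * H 0%N = p * t 0%N 0%N - v.
Hypothesis HS : forall r, l * H r.+1 =
  p * \sum_(k < r.+2) 'C(r.+1, k)%:R * t k (r.+1 - k)%N - r.+1%:R * H r.
Hypothesis mS : forall r, m r.+1 = l * H r.+1 + (r.+1)`!%:R / mu ^+ r.+1 * kappa.

Let c r : R := (-1) ^+ r / r`!%:R.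

Let f1 : 1`! = 1%N. Proof. by []. Qed.

Let sum1 : \sum_(k < 2) 'C(1, k)%:R * t k (1 - k)%N = t 0%N 1%N + t 1%N 0%N.
Proof.
rewrite !big_ord_recl big_ord0 addr0.
by congr (_ + _); exact: mul1r.
Qed.

Let sum2 : \sum_(k < 3) 'C(2, k)%:R * t k (2 - k)%N =
  t 0%N 2%N + 2 * t 1%N 1%N + t 2%N 0%N.
Proof.
rewrite !big_ord_recl big_ord0 addr0 addrA.
by congr (_ + _ + _); exact: mul1r.
Qed.

(** The recurrence for [H] bottoms out at [l * H 0], which is a probability and not a moment; so [v]
    and [kappa] survive here as constants. *)
Lemma first_moment_recursion : m 1%N * (l * mu) =
  p * (t 0%N 1%N + t 1%N 0%N) * (l * mu) - mu * (p * t 0%N 0%N - v) + l * kappa.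
Proof.
rewrite mS HS sum1 -H0 f1 expr1.
by field.
Qed.

Lemma second_moment_recursion : m 2%N * (l * mu) =
  p * (t 0%N 2%N + 2 * t 1%N 1%N + t 2%N 0%N) * (l * mu)
  - 2 * (p * l * (t 0%N 1%N + t 1%N 0%N) + (mu - l) * m 1%N
         - (p * t 0%N 0%N - v) - kappa).
Proof.
have h1 : H 1%N = (p * (t 0%N 1%N + t 1%N 0%N) - H 0%N) / l.
  by apply: (mulfI l0); rewrite HS sum1; field.
have f2 : 2`! = 2%N by [].
rewrite (mS 1) (mS 0) (HS 1) sum2 h1 f1 expr1 f2 -H0.
by field; rewrite mu0 l0.
Qed.

Let c0 : c 0 = 1. Proof. by rewrite /c expr0 fact0 divr1. Qed.
Let c1 : c 1 = -1. Proof. by rewrite /c expr1 f1 divr1. Qed.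
Let c2 : c 2 = 2^-1. Proof. by rewrite /c sqrrN expr1n mul1r. Qed.
Let cS r : c r.+1 * r.+1%:R = - c r.
Proof.
have f0 : (r`!%:R : R) != 0 by rewrite pnatr_eq0 -lt0n fact_gt0.
have r0 : (r.+1%:R : R) != 0 by rewrite pnatr_eq0.
rewrite /c factS natrM exprS; move: (r.+1%:R : R) r0 => x x0.
by field; rewrite x0 f0.
Qed.

(** Dividing by $r!$ splits the binomial coefficient into $1/(k!(r-k)!)$, and the sign splits
    likewise: the sum becomes a convolution. *)
Let sumS r : c r * (\sum_(k < r.+1) 'C(r, k)%:R * t k (r - k)%N) =
  \sum_(k < r.+1) c k * (c (r - k)%N * t k (r - k)%N).
Proof.
rewrite mulr_sumr; apply: eq_bigr => -[k /=]; rewrite ltnS => kr _.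
rewrite !mulrA; congr (_ * _); rewrite /c -{1}(subnKC kr) exprD.
rewrite -(bin_fact kr) !natrM; field.
by rewrite !pnatr_eq0 -!lt0n !fact_gt0 bin_gt0.
Qed.

(** With $x_r = c_r m_r = A_r + K_r$ for $r \ge 1$, the factor [c] yields constant coefficients: $l
    A_{r+1} - A_r = l p T_{r+1}$ and $\mu K_{r+1} + K_r = 0$. Applying both operators removes [H]
    and [kappa] together: $l\mu x_{r+2} + (l-\mu)x_{r+1} - x_r = l p(\mu T_{r+2} + T_{r+1})$. The
    restriction $r \ge 1$ is why this regular form starts at order 3. *)
Lemma higher_moment_recursion s :
  c s.+3 * (m s.+3 - p * t s.+3 0%N) * (l * mu) =
  c s.+1 * (p * (2^-1 * t s.+1 2%N * (l * mu) - t s.+1 1%N * l) + m s.+1)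
  + c s.+2 * (p * (t s.+2 0%N * l - t s.+2 1%N * (l * mu)) + (mu - l) * m s.+2)
  + p * \sum_(0 <= k < s.+1) c k * (c (s.+3 - k - 1)%N * t k (s.+3 - k - 1)%N * l
      + c (s.+3 - k)%N * t k (s.+3 - k)%N * (l * mu)).
Proof.
pose T r := \sum_(k < r.+1) c k * (c (r - k)%N * t k (r - k)%N).
pose K r := (-1) ^+ r / mu ^+ r * kappa.
pose A r := c r * (l * H r).
have AS r : A r.+1 = p * T r.+1 + c r * H r.
  have -> : c r = - (c r.+1 * r.+1%:R) by rewrite cS opprK.
  by rewrite /A HS /T -sumS; ring.
have am r : c r.+1 * m r.+1 = A r.+1 + K r.+1.
  have f0 : ((r.+1)`!%:R : R) != 0 by rewrite pnatr_eq0 -lt0n fact_gt0.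
  have y0 : mu ^+ r.+1 != 0 by rewrite expf_neq0.
  rewrite mS mulrDr -/(A _) /K /c; congr (_ + _).
  move: (mu ^+ r.+1) y0 ((r.+1)`!%:R : R) f0 => y y0 f f0.
  by field; rewrite y0 f0.
have KS r : mu * K r.+1 = - K r.
  have y0 : mu ^+ r != 0 by rewrite expf_neq0.
  rewrite /K !exprS; move: (mu ^+ r) y0 => y y0.
  by field; rewrite mu0 y0.
have lcH r : l * (c r * H r) = A r by rewrite /A mulrCA.
(* The summands $k = s+1, s+2, s+3$ are split off with $c_2 = 1/2$, $c_1 = -1$, $c_0 = 1$; these are
   the explicit coefficients of the final matrices, and the indices up to $s$ form the tail sum. *)
have T3 : T s.+3 = \sum_(0 <= k < s.+1) c k * (c (s.+3 - k)%N * t k (s.+3 - k)%N)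
    + c s.+1 * (2^-1 * t s.+1 2%N) - c s.+2 * t s.+2 1%N + c s.+3 * t s.+3 0%N.
  rewrite /T 3!big_ord_recr/= subnn subSnn (subSn (leqnSn _)) subSnn c0 c1 c2 big_mkord.
  by ring.
have T2 : T s.+2 = \sum_(0 <= k < s.+1) c k * (c (s.+3 - k - 1)%N * t k (s.+3 - k - 1)%N)
    - c s.+1 * t s.+1 1%N + c s.+2 * t s.+2 0%N.
  rewrite /T 2!big_ord_recr/= subnn subSnn c0 c1 big_mkord.
  under [in RHS]eq_bigr do rewrite subnAC subn1.
  by rewrite /=; ring.
(* [H s.+2] and [K s.+3] are kept as free quantities; the other overflow and [kappa] terms are
   expressed through them, and they cancel. *)
have e : c s.+3 * m s.+3 * (l * mu) = p * T s.+3 * (l * mu)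
    + (mu - l) * (c s.+2 * m s.+2) + l * p * T s.+2 + c s.+1 * m s.+1.
  have hH : c s.+1 * H s.+1 = l * (c s.+2 * H s.+2) - p * T s.+2.
    by rewrite lcH AS addrC addKr.
  have K2 : K s.+2 = - (mu * K s.+3) by rewrite KS opprK.
  have K1 : K s.+1 = mu * (mu * K s.+3) by rewrite KS mulrN KS opprK.
  rewrite !am AS -(lcH s.+2) -(lcH s.+1) hH K2 K1; ring.
have sumD : \sum_(0 <= k < s.+1) c k * (c (s.+3 - k - 1)%N * t k (s.+3 - k - 1)%N * l
      + c (s.+3 - k)%N * t k (s.+3 - k)%N * (l * mu)) =
    (\sum_(0 <= k < s.+1) c k * (c (s.+3 - k - 1)%N * t k (s.+3 - k - 1)%N)) * l +
    (\sum_(0 <= k < s.+1) c k * (c (s.+3 - k)%N * t k (s.+3 - k)%N)) * (l * mu).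
  rewrite !mulr_suml -big_split; apply: eq_bigr => k _ /=.
  by rewrite mulrDr !mulrA.
rewrite sumD mulrBr mulrBl e T3 T2; ring.
Qed.

End moment_recursion.

(** * Entries of the vector equations *)

Section entries.
Context (R : realType) (N : nat).
Variables (P : 'M[R]_N) (p : R) (lam mu : 'rV[R]_N) (m gam : nat -> 'rV[R]_N).
Hypothesis gam0 : forall i, gam 0%N 0 i = 1.

(** These are the only quantities that mix states: $\Lambda$ and $M$ stand to the right of $P$ and
    act entrywise, so each vector equation splits into one scalar equation per state [j]. *)
Definition mixed_moment (r k : nat) j : R :=
  \sum_i m r 0 i * gam k 0 i * P i j.

Lemma mixed_momentE r k j :
  (m r *m diag_mx (gam k) *m P) 0 j = mixed_moment r k j.
Proof. by rewrite mxE; apply: eq_bigr => i _; rewrite mul_mx_diag mxE. Qed.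

Lemma mixed_moment0 r j : (m r *m P) 0 j = mixed_moment r 0 j.
Proof. by rewrite mxE; apply: eq_bigr => i _; rewrite gam0 mulr1. Qed.

Let mul_diagE (A : 'rV[R]_N) (v : 'rV[R]_N) j : (A *m diag_mx v) 0 j = A 0 j * v 0 j.
Proof. by rewrite mul_mx_diag mxE. Qed.

Let addE (A B : 'rV[R]_N) j : (A + B) 0 j = A 0 j + B 0 j.
Proof. by rewrite mxE. Qed.
Let oppE (A : 'rV[R]_N) j : (- A) 0 j = - A 0 j.
Proof. by rewrite mxE. Qed.
Let scaleE a (A : 'rV[R]_N) j : (a *: A) 0 j = a * A 0 j.
Proof. by rewrite mxE. Qed.
Let rowE := (addE, oppE, scaleE, mul_diagE, mixed_momentE, mixed_moment0).

Lemma linear_coefficientE k j :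
  (m k *m (p *: (P *m diag_mx lam
      - diag_mx (gam 1%N) *m P *m diag_mx lam *m diag_mx mu)
    + diag_mx mu - diag_mx lam)) 0 j =
  p * (mixed_moment k 0 j * lam 0 j - mixed_moment k 1 j * (lam 0 j * mu 0 j))
  + (mu 0 j - lam 0 j) * m k 0 j.
Proof.
rewrite mulmxBr mulmxDr -scalemxAr mulmxBr !mulmxA !rowE; ring.
Qed.

Lemma constant_coefficientE k j :
  (m k *m (p *: (2^-1 *: (diag_mx (gam 2%N) *m P *m diag_mx lam *m diag_mx mu)
      - diag_mx (gam 1%N) *m P *m diag_mx lam) + 1%:M)) 0 j =
  p * (2^-1 * mixed_moment k 2 j * (lam 0 j * mu 0 j)
       - mixed_moment k 1 j * lam 0 j) + m k 0 j.
Proof.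
rewrite mulmxDr -scalemxAr mulmxBr -scalemxAr mulmx1 !mulmxA !rowE; ring.
Qed.

Lemma tail_coefficientE k r s (a b : R) j :
  (m k *m (a *: (diag_mx (gam r) *m P *m diag_mx lam)
    + b *: (diag_mx (gam s) *m P *m diag_mx lam *m diag_mx mu))) 0 j =
  a * mixed_moment k r j * lam 0 j
  + b * mixed_moment k s j * (lam 0 j * mu 0 j).
Proof.
rewrite mulmxDr -!scalemxAr !mulmxA !rowE; ring.
Qed.

Lemma top_coefficientE k j :
  (m k *m (1%:M - p *: P) *m (diag_mx lam *m diag_mx mu)) 0 j =
  (m k 0 j - p * mixed_moment k 0 j) * (lam 0 j * mu 0 j).
Proof.
rewrite mulmxBr mulmx1 -scalemxAr !mulmxA !rowE; ring.
Qed.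

End entries.

Lemma unitmx_diag (R : realType) (N : nat) (v : 'rV[R]_N) :
  (forall i, 0 < v 0 i) -> diag_mx v \in unitmx.
Proof.
move=> v0; rewrite unitmxE det_diag unitfE.
by apply/prodf_neq0 => i _; rewrite gt_eqF.
Qed.

Theorem theorem5 (R : realType) (N : nat)
  (d : measure_display) (T : measurableType d) (Pr : probability T R)
  (P : 'M[R]_N) (pi : 'cV[R]_N) (p : R) (lam mu : 'rV[R]_N)
  (B C : 'I_N -> probability R R)
  (Z : nat -> T -> 'I_N) (V W S A Cn D : nat -> {RV Pr >-> R})
  (Phi : 'I_N -> R[i] -> R[i]) (m gam : nat -> 'rV[R]_N)
  (hP : stochastic P) (hirr : irreducible P) (hpi : stationary P pi)
  (hp : 0 < p < 1)
  (hmodel : model_II Pr P p lam mu B C Z V W S A Cn D)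
  (hPhi : forall i s, 0 <= complex.Re s ->
    ccvg (fun n => transform Pr Z W n i s) (Phi i s))
  (hm : forall r i, moment Pr Z W n r i @[n --> \oo] --> (m r 0 i)%:E)
  (hgam : forall r i,
    (\int[B i]_(x in `[0%R, +oo[) (x ^+ r)%:E)%E = (gam r 0 i)%:E) :
  let La := diag_mx lam in
  let M := diag_mx mu in
  let G r := diag_mx (gam r) in
  let I := 1%:M : 'M[R]_N in
  let k1 := k1 P p lam mu B C pi Phi in
  let k2 := k2 P p lam mu B C pi Phi in
  let Q1 := p *: (P *m La - G 1%N *m P *m La *m M) + M - La in
  let Q2 := p *: (2^-1 *: (G 2%N *m P *m La *m M) - G 1%N *m P *m La) + I in
  let c r : R := (-1) ^+ r / (r`!)%:R in
  [/\ m 0%N = pi^T,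
      m 1%N = (m 0%N *m Q1 - k1) *m invmx (La *m M) *m invmx (p *: P - I),
      m 2%N = 2 *: (k2 + m 1%N *m Q1 - m 0%N *m Q2)
                *m invmx (La *m M) *m invmx (p *: P - I)
    & forall r : nat, (3 <= r)%N ->
      c r *: (m r *m (I - p *: P) *m (La *m M)) =
        c (r - 2)%N *: (m (r - 2)%N *m Q2)
        + c (r - 1)%N *: (m (r - 1)%N *m Q1)
        + p *: \sum_(0 <= j < (r - 3).+1)
            c j *: (m j *m
              (c (r - j - 1)%N *: (G (r - j - 1)%N *m P *m La)
               + c (r - j)%N *: (G (r - j)%N *m P *m La *m M)))].
Proof.
move=> La M G I k1' k2' Q1 Q2 c.
have lam0 := mII_lam hmodel; have mu0 := mII_mu hmodel.
have gam0 i : gam 0%N 0 i = 1.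
  apply: EFin_inj; rewrite -hgam; under eq_integral do rewrite expr0.
  rewrite integral_cst// mul1e.
  exact: (mII_B hmodel).
have m0P := limit_state_step hP hp hmodel hm.
have m0 : m 0%N = pi^T.
  case: hpi => _ pi1 piP; apply/eqP; rewrite -subr_eq0; apply/eqP.
  (* The difference of two invariant vectors of total mass 1 is invariant with sum 0. *)
  apply: (invariant_sum0_eq0 hP hirr); first by rewrite mulmxBl m0P piP.
  under eq_bigr do rewrite !mxE.
  by rewrite sumrB (limit_state_sum hmodel hm) pi1 subrr.
have uLM : La *m M \in unitmx by rewrite unitmx_mul !unitmx_diag.
have uP : p *: P - I \in unitmx by exact: unitmx_substochastic.
have pi_row j : m 0%N 0 j = pi j 0 by rewrite m0 mxE.
pose t j r k := mixed_moment P m gam r k j.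
(* Invariance of [m 0] turns the order-0 mixed moment into [pi j 0], so that the terms with [p] and
   [1 - p] can be matched with those in [k1] and [k2]. *)
have t00 j : t j 0%N 0%N = pi j 0 by rewrite /t -mixed_moment0// m0P pi_row.
pose H j r := \sum_i limit_overflow P p lam B Phi m gam r i j.
(* By the definition of [vm1] this is $q\sum_i p_{i,j}c_i^*(\mu_j)\Phi_{W,i}(\mu_j)$, the form in
   which it appears in [limit_moment]. *)
pose kappa j := (1 - p) * pi j 0 - vm1 P p mu C pi Phi j.
pose v j := v1 P p lam B Phi j.
have ln0 j : lam 0 j != 0 by rewrite gt_eqF.
have mn0 j : mu 0 j != 0 by rewrite gt_eqF.
have H0 j : lam 0 j * H j 0%N = p * t j 0%N 0%N - v j.
  rewrite /H /t /mixed_moment /v /v1 !mulr_sumr -sumrB; apply: eq_bigr => i _ /=.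
  by rewrite gam0; field.
have HS j r : lam 0 j * H j r.+1 =
    p * \sum_(k < r.+2) 'C(r.+1, k)%:R * t j k (r.+1 - k)%N - r.+1%:R * H j r.
  rewrite /H /t /mixed_moment.
  under [in RHS]eq_bigr do rewrite mulr_sumr.
  rewrite exchange_big /= !mulr_sumr -sumrB; apply: eq_bigr => i _.
  rewrite mulrCA divff// mulr1; congr (_ - _).
  rewrite -mulrA; congr (_ * _); rewrite mulr_sumr.
  by apply: eq_bigr => k _; ring.
have mS j r : m r.+1 0 j = lam 0 j * H j r.+1 +
    (r.+1)`!%:R / mu 0 j ^+ r.+1 * kappa j.
  rewrite (limit_moment hP hp hmodel hPhi hm hgam) big_split /= -!mulr_sumr.
  congr (_ + _ * _); rewrite /kappa /vm1 -mulrBr subKr mulr_sumr.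
  by apply: eq_bigr => i _; ring.
have topE := @top_coefficientE R N P p lam mu m gam gam0.
have linE := @linear_coefficientE R N P p lam mu m gam gam0.
have cstE := @constant_coefficientE R N P p lam mu m gam.
split => //.
- suff h : m 1%N *m (p *: P - I) *m (La *m M) = m 0%N *m Q1 - k1'.
    by rewrite -h !mulmxK.
  (* The sign is flipped because [topE] is stated for [I - p *: P], while the claim inverts
     [p *: P - I]. *)
  apply/rowP => j; rewrite -opprB mulmxN mulNmx [LHS]mxE.
  rewrite /La /M topE [RHS]mxE /Q1 linE !mxE.
  rewrite -!/(t j _ _) pi_row.
  have := first_moment_recursion (m := fun r => m r 0 j) (mn0 j) (H0 j)
    (HS j) (mS j).
  rewrite t00 => h; rewrite mulrBl h /kappa /v; ring.
- suff h : m 2%N *m (p *: P - I) *m (La *m M) =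
      2 *: (k2' + m 1%N *m Q1 - m 0%N *m Q2).
    by rewrite -h !mulmxK.
  apply/rowP => j; rewrite -opprB mulmxN mulNmx [LHS]mxE.
  rewrite /La /M topE.
  rewrite [RHS]mxE [X in _ = _ * X]mxE [X in _ = _ * (X + _)]mxE.
  rewrite [X in _ = _ * (_ + X)]mxE.
  rewrite /Q1 /Q2 linE cstE !mxE.
  rewrite -!/(t j _ _) pi_row.
  have := second_moment_recursion (m := fun r => m r 0 j) (ln0 j) (mn0 j) (H0 j)
    (HS j) (mS j).
  rewrite t00 => h; rewrite mulrBl h /kappa /v; by field.

- move=> r; case: r => [|[|[|s]]]// _; apply/rowP => j.
  rewrite (_ : (s.+3 - 2 = s.+1)%N)// (_ : (s.+3 - 1 = s.+2)%N)//.
  rewrite (_ : (s.+3 - 3 = s)%N); last by rewrite -addn3 addnK.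
  rewrite mxE /La /M topE mulrA.
  rewrite /c (higher_moment_recursion (m := fun r => m r 0 j) (mn0 j) (HS j) (mS j)).
  rewrite [RHS]mxE [X in _ = X + _]mxE [X in _ = X + _ + _]mxE [X in _ = _ + X + _]mxE.
  rewrite /Q1 /Q2 linE cstE [X in _ = _ + X]mxE.
  rewrite summxE; congr (_ + _ + _ * _).
    apply: eq_bigr => k _; rewrite mxE; congr (_ * _).
    by rewrite tail_coefficientE.
Qed.
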